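(* Let $p$ be a prime, let $K$ be an algebraically closed field of characteristic $p$, let $n\ge 0$ and $d>2$ be integers, and let $f\in\Pi_{(d),n,K}\setminus\Sigma_{(d),n,K}$. Then the prime-to-$p$ part of the order of the subgroup $\{A\in\mathrm{GL}_{n+1}(K) : f\circ A=f\}$ divides $$\prod_{i=0}^n\bigl((-1)^{n-i}+(d-1)^{n-i+1}\bigr)(d-1)^i.$$
   Context: $\Pi_{(d),n,K}$ is the $K$-vector space of homogeneous polynomials of degree $d$ in $n+1$ variables $x_0,\dots,x_n$ with coefficients in $K$. $\Sigma_{(d),n,K}\subset\Pi_{(d),n,K}$ is the subset of those $f$ for which there is $x\in K^{n+1}\setminus\{0\}$ with $f(x)=0$ and $\frac{\partial f}{\partial x_j}(x)=0$ for all $j=0,\dots,n$ (for $n\ge 1$, $f\notin\Sigma_{(d),n,K}$ means that $f=0$ is a smooth hypersurface in $\mathbb{P}^n_K$). The group $\mathrm{GL}_{n+1}(K)$ acts on polynomials by linear substitutions, $(f,A)\mapsto f\circ A$. The prime-to-$p$ part of a positive integer $N$ is the largest divisor of $N$ that is coprime to $p$. *)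

(* Defs.v *)
From HB Require Import structures.
From mathcomp Require Import all_boot all_order all_algebra.
From mathcomp Require Import finmap.
From mathcomp.multinomials Require Import mpoly.

Set Implicit Arguments.
Unset Strict Implicit.
Unset Printing Implicit Defensive.

Import GRing.Theory.
Local Open Scope ring_scope.

(* The vanishing of f at x is a separate condition: when the characteristic
   divides the degree, it does not follow from that of the partial derivatives
   by Euler's identity. *)
Definition singular_form (K : fieldType) (n : nat) (f : {mpoly K[n.+1]}) : Prop :=
  exists x : 'rV[K]_n.+1,
    [/\ x != 0, f.@[x 0] = 0 & forall j : 'I_n.+1, f^`M(j).@[x 0] = 0].

(* (f \o A)(x) = f (A x) for column vectors x, i.e. x_i is replaced by
   \sum_j A i j x_j. *)
Definition lin_subst (K : fieldType) (n : nat) (f : {mpoly K[n.+1]})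
    (A : 'M[K]_n.+1) : {mpoly K[n.+1]} :=
  f \mPo [tuple \sum_(j < n.+1) A i j *: 'X_j | i < n.+1].

Definition lin_stab (K : fieldType) (n : nat) (f : {mpoly K[n.+1]})
    (A : 'M[K]_n.+1) : Prop :=
  A \in unitmx /\ lin_subst f A = f.

(* Main.v *)
Require Import Defs.
From HB Require Import structures.
From Stdlib Require Import Classical.
From mathcomp Require Import all_boot all_fingroup all_algebra all_solvable all_field.
From mathcomp Require Import mxrepresentation.
From mathcomp Require Import finmap.
From mathcomp Require Import zify ring.
From mathcomp.real_closed Require Import mxtens.
From mathcomp.multinomials Require Import mpoly.

Set Implicit Arguments.
Unset Strict Implicit.
Unset Printing Implicit Defensive.

Import GRing.Theory.
Local Open Scope ring_scope.

(** Put q = 1 - d. Up to sign the bound is the product over k <= n of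
    q^(n+1) - q^k (stab_boundE). It is the value at the identity of a virtual character
    that vanishes elsewhere, which explains the divisibility.

    Let L be a Sylow subgroup of the stabilizer for a prime other than p. Eigenvalues
    of its elements are roots of unity of order prime to p, and lift to algC; the sum of
    the lifts is the Brauer character of a representation. The sum over L of a Brauer
    character is |L| times the dimension of the space of invariants
    (sum_brauer_trace_coset, sum_virtual_char). Suppose that

      psi (g) = q ^ (dimension of the fixed space of g)

    is a difference of Brauer characters. Then so is the product of the psi - q^k for
    k <= n. It is zero at each g <> 1, because psi (g) is one of the q^k, and is the bound
    at g = 1, so |L| divides the bound (card_dvd_stab_bound).

    To see that psi is a virtual character, let a_i be the lifted eigenvalues of g and
    put A = prod_i (1 - X^(d-1) / a_i) and B = prod_i (1 - a_i X). A partial derivative of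
    f along an eigenvector with eigenvalue nu restricts to the eigenspace of mu as zero
    unless nu = mu^(1-d). Since f is smooth, and since fewer forms than variables have
    a common nontrivial zero, the eigenspace of mu^(1-d) is at least as large as that of
    mu (diag_stab_eigenvalues). This says that B divides A (elem_sym_dvd). When p does not
    divide d, the quotient Q = A / B is the graded character of the ring of polynomials
    modulo the partial derivatives of f. Evaluation gives psi (g) = Q(1) * prod_i (- a_i)
    (elem_sym_quotient1). Finally Q(1) is the sum of the coefficients of the power series
    A * (1 / B) in low degree, which are virtual characters as they are built from
    exterior and symmetric powers (virtual_elem_sym, virtual_complete_sym).

    The stabilizer is finite for the following reason (lin_stab_finite). From
    f (A x) = f x one gets grad f (A x) = grad f (x) * A^-1. By the Nullstellensatz the
    D-th powers of the coordinates of A x lie in the ideal of f and its partial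
    derivatives at A x, which expresses them in lower degree in the entries of A and
    A^-1 as soon as d > 2. So these entries generate a finite-dimensional algebra of
    functions on the stabilizer, and they separate its points.

    Both geometric inputs, on common zeros of few forms and on powers of the variables,
    follow from the Nullstellensatz, which is proved by projecting along a generic line
    and taking resultants. *)

(** * The Nullstellensatz *)

Lemma rmorph_mmap n (R : nzRingType) (S T : comNzRingType) (phi : {rmorphism S -> T})
    (f : {rmorphism R -> S}) (h : 'I_n -> S) (P : {mpoly R[n]}) :
  phi (mmap f h P) = mmap (phi \o f) (phi \o h) P.
Proof.
rewrite /mmap rmorph_sum; apply: eq_bigr => m _.
rewrite rmorphM /mmap1 rmorph_prod; congr (_ * _).
by apply: eq_bigr => i _; rewrite rmorphXn.
Qed.

Lemma mmap_ext n (R S : nzRingType) (f g : R -> S) (h k : 'I_n -> S)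
    (P : {mpoly R[n]}) :
  f =1 g -> h =1 k -> mmap f h P = mmap g k P.
Proof.
move=> fg hk; rewrite /mmap; apply: eq_bigr => m _.
by rewrite fg (mmap1_eq _ hk).
Qed.

Lemma base_expansion_inj (n B : nat) (f g : nat -> nat) :
  (forall i, i < n -> f i < B)%N -> (forall i, i < n -> g i < B)%N ->
  (\sum_(i < n) f i * B ^ i = \sum_(i < n) g i * B ^ i)%N ->
  forall i, (i < n)%N -> f i = g i.
Proof.
elim: n f g => [|n IHn] f g // fB gB.
rewrite !big_ord_recl !expn0 !muln1.
have shift (u : nat -> nat) :
    (\sum_(i < n) u (bump 0 i) * B ^ bump 0 i
      = (\sum_(i < n) u i.+1 * B ^ i) * B)%N.
  by rewrite big_distrl; apply: eq_bigr => i _; rewrite /= expnSr mulnA.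
rewrite !shift => Esum.
have B_gt0 : (0 < B)%N by apply: leq_ltn_trans (fB 0%N _).
have E0 : f 0%N = g 0%N.
  by have /(congr1 (modn^~ B)) := Esum; rewrite ![(_ + _ * B)%N]addnC !modnMDl !modn_small ?fB ?gB.
case=> [|i] ltin //.
move/eqP: Esum; rewrite E0 eqn_add2l eqn_pmul2r // => /eqP Esum.
by apply: (IHn (fun i => f i.+1) (fun i => g i.+1) _ _ Esum) => // j ?;
  [apply: fB | apply: gB].
Qed.

(** Kronecker's substitution turns a polynomial in several variables into one in
    a single variable without merging monomials, so nonvanishing reduces to the
    univariate case. *)
Lemma mpoly_nonzero_value (K : closedFieldType) n (P : {mpoly K[n]}) :
  P != 0 -> exists v : 'I_n -> K, P.@[v] != 0.
Proof.
move=> P0; have [m0 m0P] : exists m, m \in msupp P.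
  by move: P0; rewrite -msupp_eq0; case: (msupp P) => // m s _; exists m; rewrite inE eqxx.
pose B := msize P; pose e (m : 'X_{1..n}) := (\sum_(i < n) m i * B ^ i)%N.
have mB m (i : 'I_n) : m \in msupp P -> (m i < B)%N.
  move/msize_mdeg_lt; apply: leq_ltn_trans.
  by rewrite mdegE (bigD1 i) //= leq_addr.
have e_inj m : m \in msupp P -> e m = e m0 -> m = m0.
  move=> mP Eem; apply/mnmP => i.
  pose c (m' : 'X_{1..n}) k := if insub k is Some j then m' j else 0%N : nat.
  have cE m' (j : 'I_n) : c m' j = m' j by rewrite /c valK.
  rewrite -!cE; apply: (@base_expansion_inj n B) => //.
  - by move=> k ltkn; rewrite (cE m (Ordinal ltkn)) mB.
  - by move=> k ltkn; rewrite (cE m0 (Ordinal ltkn)) mB.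
  by rewrite (eq_bigr (fun i : 'I_n => m i * B ^ i)%N) => [|j _];
    rewrite ?cE // [LHS]Eem; apply: eq_bigr => j _; rewrite cE.
pose q := \sum_(m <- msupp P) P@_m *: 'X^(e m) : {poly K}.
have q0 : q != 0.
  apply: contraTneq (m0P) => /(congr1 (fun q : {poly K} => q`_(e m0))).
  rewrite coef0 coef_sum (bigD1_seq m0) ?msupp_uniq //= coefZ coefXn eqxx mulr1.
  rewrite big_seq_cond big1 ?addr0 => [|m /andP[mP m_m0]].
    by rewrite mcoeff_msupp => ->; rewrite eqxx.
  rewrite coefZ coefXn; case: eqP => [E|]; last by rewrite mulr0.
  by rewrite (e_inj _ mP) ?E ?eqxx in m_m0.
have [z qz] := closed_nonrootP _ q0.
exists (fun i : 'I_n => z ^+ (B ^ i)).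
apply: contraNneq qz; rewrite mevalE => Pz; rewrite /root /q horner_sum.
apply/eqP; rewrite -[RHS]Pz; apply: eq_bigr => m _.
rewrite hornerZ hornerXn /e -prodrXr; congr (_ * _).
by apply: eq_bigr => i _; rewrite -exprM mulnC.
Qed.

Lemma ex_minimal (P : nat -> Prop) :
  (exists n, P n) -> exists2 n, P n & forall k, (k < n)%N -> ~ P k.
Proof.
case=> n; elim/ltn_ind: n => n IHn Pn.
have [[k ltkn Pk]|H] := classic (exists2 k, (k < n)%N & P k).
  exact: IHn Pk.
by exists n => // k ltkn Pk; apply: H; exists k.
Qed.

Record is_ideal (R : nzRingType) (I : R -> Prop) : Prop := IsIdeal {
  ideal0 : I 0;
  idealD : forall a b, I a -> I b -> I (a + b);
  idealMl : forall a b, I b -> I (a * b) }.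

Lemma ideal_sum (R : nzRingType) (I : R -> Prop) (T : Type) (r : seq T)
    (P : pred T) (F : T -> R) :
  is_ideal I -> (forall i, P i -> I (F i)) -> I (\sum_(i <- r | P i) F i).
Proof.
move=> [I0 ID _] IF; elim/big_rec: _ => // i x Pi Ix.
by apply: ID => //; apply: IF.
Qed.

(** An ideal of the principal ideal ring K[T] is generated by any nonzero element
    of least degree, whose roots are then common to the whole ideal. *)
Lemma proper_ideal_root (K : closedFieldType) (J : {poly K} -> Prop) :
  is_ideal J -> (exists2 g, J g & g != 0) -> ~ J 1 ->
  exists b, forall q, J q -> q.[b] = 0.
Proof.
move=> [J0 JD JM] [g Jg g0] J1.
have [|s [h [Jh h0 sh]] hmin] :=
    @ex_minimal (fun s => exists h, [/\ J h, h != 0 & size h = s]).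
  by exists (size g), g.
have h_nunit : size h != 1%N.
  apply: contra_notN J1 => /size_poly1P [c c0 Eh].
  by have := JM (c^-1)%:P _ Jh; rewrite Eh -polyCM mulVf.
have [b hb] := closed_rootP _ h_nunit.
exists b => q Jq; apply/rootP; suff /dvdpP [u ->] : h %| q by rewrite rootM hb orbT.
apply/negPn/negP => nhq; apply: (hmin (size (q %% h))).
  by rewrite -sh ltn_modp.
exists (q %% h); split=> //.
have -> : q %% h = q + (- (q %/ h)) * h.
  by rewrite {2}(divp_eq q h) mulNr addrAC subrr add0r.
by apply: JD => //; apply: JM.
Qed.

Lemma coef_mul_top (R : comNzRingType) (p q : {poly R}) a b :
  (size p <= a.+1)%N -> (size q <= b.+1)%N ->
  (size (p * q)%R <= (a + b).+1)%N /\ (p * q)`_(a + b) = p`_a * q`_b.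
Proof.
move=> sp sq; split.
  by rewrite (leq_trans (size_polyMleq _ _)) //; lia.
have lta : (a < (a + b).+1)%N by rewrite ltnS leq_addr.
rewrite coefM (bigD1 (Ordinal lta)) //= addKn big1 ?addr0 // => i ia.
have [ltia|leai] := ltnP i a.
  by rewrite [q`__]nth_default ?mulr0 // (leq_trans sq) //; lia.
have ltai : (a < i)%N.
  by rewrite ltn_neqAle leai andbT; apply: contraNneq ia => E; apply/eqP/val_inj.
by rewrite [p`__]nth_default ?mul0r // (leq_trans sp).
Qed.

Lemma mcoeff_pihomog (R : nzRingType) n d (p : {mpoly R[n]}) m :
  (pihomog mdeg d p)@_m = if mdeg m == d then p@_m else 0.
Proof.
rewrite pihomogE linear_sum /=.
have [mP|mP] := boolP (m \in msupp p); last first.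
  rewrite (memN_msupp_eq0 mP) if_same big_seq_cond big1 // => k /andP[kP _].
  by rewrite mcoeffZ mcoeffX; case: eqP => [E|_]; [rewrite -E kP in mP | rewrite mulr0].
rewrite big_mkcond (bigD1_seq m) ?msupp_uniq //= big1 ?addr0 => [|k km].
  by case: ifP; rewrite // mcoeffZ mcoeffX eqxx mulr1.
by case: ifP; rewrite // mcoeffZ mcoeffX (negPf km) mulr0.
Qed.

Lemma map_resultant_rmorph (R S : comNzRingType) (f : {rmorphism R -> S})
    (p q : {poly R}) :
  f (lead_coef p) != 0 -> f (lead_coef q) != 0 ->
  f (resultant p q) = resultant (map_poly f p) (map_poly f q).
Proof.
move=> fp fq; rewrite /resultant /Sylvester_mx !size_map_poly_id0 //.
rewrite -det_map_mx /= map_col_mx; congr (\det (col_mx _ _));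
  by apply: map_lin1_mx => v; rewrite map_poly_rV rmorphM /= map_rVpoly.
Qed.

Section Nullstellensatz.

Variables (K : closedFieldType) (R : comAlgType K) (I : R -> Prop).
Hypotheses (Iideal : is_ideal I) (I1 : ~ I 1).

Let at_pt m (t : 'I_m -> R) (P : {mpoly K[m]}) : R := mmap (in_alg R) t P.

Let I_const (c : K) : c != 0 -> ~ I c%:A.
Proof.
move=> c0 Ic; apply: I1; have := idealMl Iideal (c^-1)%:A Ic.
by rewrite mulr_algl scalerA mulVf // scale1r.
Qed.

Section Projection.

Variables (m : nat) (t : 'I_m.+1 -> R) (c : 'I_m.+1 -> K).
Hypothesis c0 : c ord0 != 0.

(** The coordinates are sheared along the direction c: the variable of the
    univariate polynomial is a coordinate on each line parallel to c, and the m
    remaining variables parametrize these lines. *)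
Let line (i : 'I_m.+1) : {poly {mpoly K[m]}} :=
  oapp (fun j => ('X_j)%:P) 0 (unlift ord0 i) + (c i)%:MP *: 'X.
Let shear (P : {mpoly K[m.+1]}) := mmap (polyC \o mpolyC m (R := K)) line P.
Let tau := (c ord0)^-1 *: t ord0.
Let y (j : 'I_m) := t (lift ord0 j) - c (lift ord0 j) *: tau.
Let y_map := mmap (in_alg R) y : {mpoly K[m]} -> R.
Let ev (Q : {poly {mpoly K[m]}}) := (map_poly y_map Q).[tau].
Let at_line (w : 'I_m -> K) (b : K) i := oapp w 0 (unlift ord0 i) + c i * b.

Let ev_shear P : ev (shear P) = at_pt t P.
Proof.
rewrite /ev -[LHS]/(horner_eval tau (map_poly y_map (shear P))) /shear.
rewrite (rmorph_mmap (map_poly y_map)) (rmorph_mmap (horner_eval tau)).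
apply: mmap_ext => [a|i] /=.
  by rewrite /horner_eval map_polyC hornerC /y_map /= mmapC.
rewrite /horner_eval /line rmorphD /= map_polyZ /= map_polyX hornerD hornerZ hornerX.
rewrite /y_map mmapC /= mulr_algl.
case: unliftP => [j ->|->] /=.
  by rewrite map_polyC hornerC /= mmapX mmap1U subrK.
by rewrite rmorph0 horner0 add0r /tau scalerA mulfV // scale1r.
Qed.

Let shear_at w b P :
  (map_poly (meval w) (shear P)).[b] = P.@[at_line w b].
Proof.
rewrite -[LHS]/(horner_eval b (map_poly (meval w) (shear P))) /shear.
rewrite (rmorph_mmap (map_poly (meval w))) (rmorph_mmap (horner_eval b)).
apply: mmap_ext => [a|i] /=.
  by rewrite /horner_eval map_polyC hornerC /= mevalC.
rewrite /horner_eval /line /at_line rmorphD /= map_polyZ /= map_polyX hornerD hornerZ hornerX.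
rewrite mevalC; case: unliftP => [j ->|->] /=.
  by rewrite map_polyC hornerC /= mevalXU.
by rewrite rmorph0 horner0.
Qed.

Let size_line i : (size (line i) <= 2)%N.
Proof.
have sC (x : {mpoly K[m]}) : (size x%:P <= 2)%N.
  exact: leq_trans (size_polyC_leq1 _) _.
apply: leq_trans (size_polyD _ _) _; rewrite geq_max; apply/andP; split.
  by case: unlift => [j|]; [apply: sC | rewrite size_poly0].
apply: leq_trans (size_scale_leq _ _) _; rewrite size_polyX; exact: leqnn.
Qed.

Let line_top i : (line i)`_1 = (c i)%:MP.
Proof.
rewrite coefD coefZ coefX mulr1.
case: unlift => [j|]; [rewrite coefC | rewrite coef0]; exact: add0r.
Qed.

Let size_mmap1_line (k : 'X_{1..m.+1}) :
  (size (mmap1 line k) <= (mdeg k).+1)%N /\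
  (mmap1 line k)`_(mdeg k) = (\prod_i c i ^+ k i)%:MP.
Proof.
rewrite /mmap1 mdegE rmorph_prod.
elim/big_rec3: _ => [|i x d z _ [sz ztop]].
  by rewrite size_poly1 coef1.
have [sX topX] : (size (line i ^+ k i) <= (k i).+1)%N /\
    (line i ^+ k i)`_(k i) = (c i ^+ k i)%:MP.
  elim: (k i) => [|e [se topE]]; first by rewrite !expr0 size_poly1 coef1 rmorph1.
  have [] := coef_mul_top (size_line i) se.
  by rewrite add1n !exprS => -> ->; rewrite line_top topE rmorphM.
by have [-> ->] := coef_mul_top sX sz; rewrite topX ztop.
Qed.

Let shear_top P D : (msize P <= D.+1)%N ->
  (size (shear P) <= D.+1)%N /\ (shear P)`_D = ((pihomog mdeg D P).@[c])%:MP.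
Proof.
move=> sP; rewrite /shear /mmap; split.
  apply: leq_trans (size_sum _ _ _) _; apply/bigmax_leqP_seq => k kP _.
  rewrite /= mul_polyC (leq_trans (size_scale_leq _ _)) //.
  have [sk _] := size_mmap1_line k; rewrite (leq_trans sk) //.
  by rewrite (leq_trans _ sP) // msize_mdeg_lt.
rewrite coef_sum pihomogE (rmorph_sum (meval c)) (rmorph_sum (@mpolyC m K)) /=.
rewrite [RHS]big_mkcond /= big_seq [RHS]big_seq; apply: eq_bigr => k kP.
have [sk topk] := size_mmap1_line k.
rewrite mul_polyC coefZ; case: eqP => [Ek|nEk].
  by rewrite -{1}Ek topk mevalZ mevalX rmorphM.
rewrite nth_default ?mulr0 // (leq_trans sk) //.
have := msize_mdeg_lt kP => /leq_trans /(_ sP); rewrite ltnS leq_eqVlt.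
by case/orP => [/eqP|].
Qed.

(** Above a point w of the projection there is a point of the zero set. The ideal
    of K[T] cut out by the line above w is proper: if some member Q had the
    value 1 along this line, then the resultant of Q and of a monic member, which
    is a member free of T, would be nonzero at w. *)
Lemma lift_zero (P : {mpoly K[m.+1]}) (w : 'I_m -> K) :
  P != 0 -> (pihomog mdeg (msize P).-1 P).@[c] != 0 -> I (at_pt t P) ->
  (forall Q : {mpoly K[m]}, I (y_map Q) -> Q.@[w] = 0) ->
  exists v, forall Q, I (at_pt t Q) -> Q.@[v] = 0.
Proof.
move=> P0; set D := (msize P).-1; set kap := meval c _ => kap0 IP w_zero.
have [sg topg] := @shear_top P D (leqSpred _); rewrite -/kap in topg.
set g := shear P in sg topg.
have kapM0 : kap%:MP_[m] != 0 by rewrite mpolyC_eq0.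
have size_g : size g = D.+1.
  apply/eqP; rewrite eqn_leq sg ltnNge; apply: contra kapM0 => sg'.
  by rewrite -topg nth_default.
have lead_g : lead_coef g = kap%:MP by rewrite lead_coefE size_g.
have D_gt0 : (0 < D)%N.
  rewrite lt0n; apply/eqP => D0; move: IP; rewrite -ev_shear -/g.
  have -> : g = (kap%:MP)%:P by rewrite -topg D0 -size1_polyC // size_g D0.
  rewrite /ev map_polyC hornerC /= /y_map mmapC; exact: I_const.
have Jideal : is_ideal (fun Q => I (ev Q)).
  split=> [|Q1 Q2|Q1 Q2]; rewrite /ev.
  - by rewrite rmorph0 horner0; apply: (ideal0 Iideal).
  - by rewrite rmorphD hornerD; apply: (idealD Iideal).
  - by rewrite rmorphM hornerM; apply: (idealMl Iideal).
pose Jw q := exists2 Q, I (ev Q) & map_poly (meval w) Q = q.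
have Jg : I (ev g) by rewrite ev_shear.
have Jwideal : is_ideal Jw.
  split=> [|_ _ [Q1 J1 <-] [Q2 J2 <-]|a _ [Q JQ <-]].
  - by exists 0; rewrite ?rmorph0 //; apply: (ideal0 Jideal).
  - by exists (Q1 + Q2); rewrite ?rmorphD //; apply: (idealD Jideal).
  exists (map_poly (mpolyC m (R := K)) a * Q); first exact: (idealMl Jideal).
  rewrite rmorphM; congr (_ * _).
  by apply/polyP => i; rewrite !coef_map /= mevalC.
have lead_gw : meval w (lead_coef g) != 0 by rewrite lead_g mevalC.
have gw0 : map_poly (meval w) g != 0.
  apply: contraNneq lead_gw => E.
  by rewrite lead_coefE -coef_map /= E coef0.
have Jw1 : ~ Jw 1.
  case=> Q JQ Qw; pose Q2 := Q + 'X^(size Q) * g.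
  have g0 : g != 0 by rewrite -size_poly_eq0 size_g.
  have sXg : size ('X^(size Q) * g) = (size Q + D.+1)%N.
    by rewrite mulrC size_mulXn // size_g addnC.
  have ltQ : (size Q < size ('X^(size Q) * g)%R)%N by rewrite sXg; lia.
  have size_Q2 : size Q2 = (size Q + D.+1)%N by rewrite /Q2 addrC size_polyDl.
  have lead_Q2 : lead_coef Q2 = lead_coef g.
    by rewrite /Q2 addrC lead_coefDl // mulrC lead_coef_Mmonic ?monicXn.
  have sQ2 : (1 < size Q2)%N by rewrite size_Q2; lia.
  have sg1 : (1 < size g)%N by rewrite size_g.
  (* The multiple of g makes Q2 monic up to kap, so that the resultant can be specialized
     at w, where Q2 becomes coprime to g. *)
  have [[u v] /= _ Eres] := resultant_in_ideal sQ2 sg1.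
  have JQ2 : I (ev Q2) by apply: (idealD Jideal JQ); apply: (idealMl Jideal).
  have Jres : I (ev (resultant Q2 g)%:P).
    by rewrite Eres; apply: (idealD Jideal); apply: (idealMl Jideal).
  move: Jres; rewrite /ev map_polyC hornerC /= => /w_zero.
  have -> : meval w (resultant Q2 g) =
      resultant (map_poly (meval w) Q2) (map_poly (meval w) g).
    by rewrite map_resultant_rmorph ?lead_Q2.
  apply/eqP; rewrite resultant_eq0 -leqNgt.
  have : gcdp (map_poly (meval w) Q2) (map_poly (meval w) g) %| 1.
    have -> : 1 = map_poly (meval w) Q2 - 'X^(size Q) * map_poly (meval w) g.
      by rewrite /Q2 rmorphD rmorphM /= map_polyXn Qw addrK.
    by rewrite dvdp_add ?dvdpNr ?dvdp_mull ?dvdp_gcdl ?dvdp_gcdr.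
  by move/(dvdp_leq (oner_neq0 _)); rewrite size_poly1.
have [|b b_root] := proper_ideal_root Jwideal _ Jw1.
  by exists (map_poly (meval w) g) => //; exists g.
exists (at_line w b) => Q IQ; rewrite -shear_at; apply: b_root.
by exists (shear Q); rewrite ?ev_shear.
Qed.

End Projection.

(** Induction on the number of elements: a nonzero relation between them is monic in one
    variable after a generic shear, and zeros lift along the projection that forgets this
    variable. If there is no relation, any point will do. *)
Lemma nullstellensatz_rel m (t : 'I_m -> R) :
  exists v, forall P : {mpoly K[m]}, I (mmap (in_alg R) t P) -> P.@[v] = 0.
Proof.
elim: m t => [|m IHm] t.
  exists (fun=> 0) => P; have -> : P = (P@_0)%:MP by rewrite -{1}[P]mpolyKC.
  rewrite mmapC mevalC; apply: contraPeq; exact: I_const.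
have [[P IP P0]|noP] := classic (exists2 P, I (at_pt t P) & P != 0); last first.
  exists (fun=> 0) => P IP; have [->|P0] := eqVneq P 0; first by rewrite meval0.
  by case: noP; exists P.
have top0 : pihomog mdeg (msize P).-1 P != 0.
  apply: contraNneq P0 => top0; rewrite -mleadc_eq0.
  have [->|P0] := eqVneq P 0; first by rewrite mcoeff0.
  have /(congr1 (mcoeff (mlead P))) := top0.
  by rewrite mcoeff0 mcoeff_pihomog -mlead_deg // eqxx => ->.
have X0 : 'X_ord0 != 0 :> {mpoly K[m.+1]}.
  by rewrite -msize_poly_eq0 msizeX.
have [c] := mpoly_nonzero_value (mulf_neq0 top0 X0).
rewrite mevalM mevalXU mulf_eq0 negb_or => /andP [top_c c0].
have [w w_zero] := IHm (fun j => t (lift ord0 j) -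
  c (lift ord0 j) *: ((c ord0)^-1 *: t ord0)).
exact: (lift_zero c0 P0 top_c IP w_zero).
Qed.

End Nullstellensatz.

Lemma nullstellensatz (K : closedFieldType) n (I : {mpoly K[n]} -> Prop) :
  is_ideal I -> ~ I 1 -> exists v, forall P, I P -> P.@[v] = 0.
Proof.
move=> Iideal I1.
have [v vP] := nullstellensatz_rel Iideal I1 (fun i => 'X_i).
exists v => P IP; apply: vP; suff -> : mmap (in_alg {mpoly K[n]}) (fun i => 'X_i) P = P by [].
rewrite [RHS]mpolyE /mmap; apply: eq_bigr => m _.
by rewrite mmap1_id /= mulr_algl.
Qed.

(** * Forms without common zero *)

Lemma pihomogM (R : nzRingType) n (h g : {mpoly R[n]}) d e :
  g \is e.-homog ->
  pihomog mdeg d (h * g) = if (e <= d)%N then pihomog mdeg (d - e) h * g else 0.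
Proof.
move=> ge; rewrite (pihomog_partitionE (mf := mdeg) (leqnn (msize h))).
rewrite mulr_suml !linear_sum mulr_suml /=.
have term (j : 'I_(msize h)) : pihomog mdeg d (pihomog mdeg j h * g) =
    if (j + e == d)%N then pihomog mdeg j h * g else 0.
  have hj := dhomogM (pihomogP mdeg j h) ge.
  by case: eqP => [<-|/eqP jd]; [apply: pihomog_dE | apply: pihomog_ne0 jd hj].
rewrite (eq_bigr _ (fun j _ => term j)); case: leqP => [led|ltd]; last first.
  by rewrite big1 // => j _; case: eqP => // E; move: ltd; rewrite -E; lia.
apply: eq_bigr => j _; case: eqP => [<-|jd].
  by rewrite addnK pihomog_id.
rewrite (@pihomog_ne0 _ _ mdeg j) ?mul0r ?pihomogP //.
by apply/eqP => E; apply: jd; rewrite E subnK.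
Qed.

Lemma msize_homog (R : nzRingType) n d (p : {mpoly R[n]}) :
  p \is d.-homog -> (msize p <= d.+1)%N.
Proof.
move/dhomogP => pd; rewrite msizeE; apply/bigmax_leqP_seq => m mp _.
by rewrite pd.
Qed.

Definition generated (R : nzRingType) s (g : 'I_s -> R) (a : R) :=
  exists h : 'I_s -> R, a = \sum_k h k * g k.

Lemma generated_ideal (R : nzRingType) s (g : 'I_s -> R) : is_ideal (generated g).
Proof.
split=> [|_ _ [h1 ->] [h2 ->]|a _ [h ->]].
- by exists (fun=> 0); rewrite big1 // => k _; rewrite mul0r.
- exists (fun k => h1 k + h2 k); rewrite -big_split; apply: eq_bigr => k _.
  by rewrite mulrDl.
exists (fun k => a * h k); rewrite mulr_sumr; apply: eq_bigr => k _.
by rewrite mulrA.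
Qed.

Section Forms.

Variables (K : closedFieldType) (n s : nat) (g : 'I_s -> {mpoly K[n]}) (e : 'I_s -> nat).
Hypothesis g_homog : forall k, g k \is (e k).-homog.
Hypothesis no_zero :
  forall v : 'I_n -> K, (forall k, (g k).@[v] = 0) -> forall i, v i = 0.

Let generated_pihomog d P : generated g P -> generated g (pihomog mdeg d P).
Proof.
case=> h ->; rewrite linear_sum /=; apply: (ideal_sum _ (generated_ideal g)) => k _.
rewrite (pihomogM _ _ (g_homog k)); case: ifP => _; last exact: (ideal0 (generated_ideal g)).
apply: (idealMl (generated_ideal g)); exists (fun j => (j == k)%:R).
by rewrite (bigD1 k) //= eqxx mul1r big1 ?addr0 // => j /negPf ->; rewrite mul0r.
Qed.

(** The affine piece where the i-th coordinate is 1 misses the zero set, so that 1 is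
    a combination of the forms and of X_i - 1. Reading off homogeneous components
    expresses that 1 - X_i has an inverse modulo the forms, namely the geometric
    series, which must then be finite. *)
Let variable_nilpotent i : exists D, generated g ('X_i ^+ D).
Proof.
apply: NNPP => nX.
pose J P := exists Q h, generated g Q /\ P = Q + h * ('X_i - 1).
have gI := generated_ideal g.
have J_ideal : is_ideal J.
  split=> [|_ _ [Q1 [h1 [G1 ->]]] [Q2 [h2 [G2 ->]]]|a _ [Q [h [G ->]]]].
  - by exists 0, 0; split; [apply: (ideal0 gI) | rewrite mul0r addr0].
  - exists (Q1 + Q2), (h1 + h2); split; first exact: (idealD gI).
    by rewrite mulrDl addrACA.
  exists (a * Q), (a * h); split; first exact: (idealMl gI).
  by rewrite mulrDr mulrA.
have [[Q [h [GQ E1]]]|J1] := classic (J 1).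
  have Xhomog : 'X_i \is [in K[n], 1.-homog] by rewrite dhomogX; apply/eqP; apply: mdeg1.
  have geo m : generated g (pihomog mdeg m h + 'X_i ^+ m).
    elim: m => [|m IHm].
      have := congr1 (pihomog mdeg 0) E1.
      rewrite mulrBr mulr1 linearD linearB /= (pihomogM _ _ Xhomog) /= sub0r.
      rewrite pihomog_dE ?dhomog1 // expr0 => ->.
      by rewrite addrCA subrr addr0; apply: generated_pihomog.
    have := congr1 (pihomog mdeg m.+1) E1.
    rewrite mulrBr mulr1 linearD linearB /= (pihomogM _ _ Xhomog) /= subn1 /=.
    rewrite (@pihomog_ne0 _ _ mdeg 0%N) ?dhomog1 // => /esym/eqP.
    rewrite addrA subr_eq add0r => /eqP <-.
    rewrite exprSr -addrA -mulrDl; apply: (idealD gI); first exact: generated_pihomog.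
    by rewrite mulrC; apply: (idealMl gI).
  apply: nX; exists (msize h); have := geo (msize h).
  suff -> : pihomog mdeg (msize h) h = 0 by rewrite add0r.
  apply/mpolyP => m; rewrite mcoeff0 mcoeff_pihomog; case: eqP => // Em.
  by rewrite memN_msupp_eq0 // msize_mdeg_ge // Em.
have [v v0] := nullstellensatz J_ideal J1.
have : v i = 0.
  apply: no_zero => k; apply: v0; exists (g k), 0; rewrite mul0r addr0; split=> //.
  exists (fun j => (j == k)%:R).
  by rewrite (bigD1 k) //= eqxx mul1r big1 ?addr0 // => j /negPf ->; rewrite mul0r.
have /eqP : ('X_i - 1).@[v] = 0.
  by apply: v0; exists 0, 1; rewrite mul1r add0r; split; first exact: (ideal0 gI).
by rewrite mevalB mevalXU meval1 subr_eq0 => /eqP -> /eqP; rewrite oner_eq0.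
Qed.

Lemma homog_nullstellensatz :
  exists D0, forall D, (D0 <= D)%N -> forall i, exists h : 'I_s -> {mpoly K[n]},
    (forall k, (msize (h k) + e k <= D.+1)%N) /\ 'X_i ^+ D = \sum_k h k * g k.
Proof.
have [E genE] := fin_all_exists variable_nilpotent.
exists (\sum_i E i + \sum_k e k)%N => D leD i.
have leE : (E i <= D)%N by move: leD; rewrite (bigD1 i) //=; lia.
have lee k : (e k <= D)%N by move: leD; rewrite [in X in (_ + X)%N](bigD1 k) //=; lia.
have [h Eh] : generated g ('X_i ^+ D).
  by rewrite -(subnK leE) exprD; apply: (idealMl (generated_ideal g)).
exists (fun k => pihomog mdeg (D - e k) (h k)); split=> [k|].
  have := msize_homog (pihomogP mdeg (D - e k) (h k)); have := lee k; lia.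
have XD : 'X_i ^+ D \is [in K[n], D.-homog].
  by rewrite mpolyXn dhomogX; apply/eqP; rewrite /= mdegMn mdeg1 mul1n.
rewrite -[LHS](pihomog_dE XD) Eh linear_sum; apply: eq_bigr => k _ /=.
by rewrite (pihomogM _ _ (g_homog k)) lee.
Qed.

End Forms.

(** A factorization of the identity matrix through T bounds its rank. *)
Lemma card_le_factor_id (K : fieldType) (I T : finType) (C : I -> T -> K) (B : T -> I -> K) :
  (forall i j, \sum_t C i t * B t j = (i == j)%:R) -> (#|I| <= #|T|)%N.
Proof.
move=> CB; pose C' := \matrix_(i < #|I|, t < #|T|) C (enum_val i) (enum_val t).
pose B' := \matrix_(t < #|T|, j < #|I|) B (enum_val t) (enum_val j).
have E : C' *m B' = 1%:M.
  apply/matrixP => i j; rewrite !mxE -(inj_eq enum_val_inj) -CB.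
  rewrite [RHS](reindex _ (onW_bij _ (@enum_val_bij T))) /=.
  by apply: eq_bigr => t _; rewrite !mxE.
by have := mulmx_max_rank C' B'; rewrite E mxrank1.
Qed.

Definition in_span (K : fieldType) (V : lmodType K) (T : finType) (F : T -> V) (x : V) :=
  exists c : T -> K, x = \sum_t c t *: F t.

Section Span.
Variables (K : fieldType) (V : lmodType K) (T : finType) (F : T -> V).

Lemma in_spanD x y : in_span F x -> in_span F y -> in_span F (x + y).
Proof.
move=> [c ->] [d ->]; exists (fun t => c t + d t).
by rewrite -big_split; apply: eq_bigr => t _; rewrite scalerDl.
Qed.

Lemma in_spanZ a x : in_span F x -> in_span F (a *: x).
Proof.
move=> [c ->]; exists (fun t => a * c t).
by rewrite scaler_sumr; apply: eq_bigr => t _; rewrite scalerA.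
Qed.

Lemma in_span0 : in_span F 0.
Proof. by exists (fun=> 0); rewrite big1 // => t _; rewrite scale0r. Qed.

Lemma in_span_gen t : in_span F (F t).
Proof.
exists (fun u => (u == t)%:R); rewrite (bigD1 t) //= eqxx scale1r big1 ?addr0 // => u.
by move/negPf ->; rewrite scale0r.
Qed.

Lemma in_span_sum I (r : seq I) (P : pred I) (G : I -> V) :
  (forall i, P i -> in_span F (G i)) -> in_span F (\sum_(i <- r | P i) G i).
Proof. by move=> GP; apply: big_ind => //; [apply: in_span0 | apply: in_spanD]. Qed.

End Span.

(** Otherwise every polynomial would be a combination, with coefficients that are
    polynomials in the s forms, of the monomials with exponents below D. In
    growing degree there are more monomials in n variables than such products. *)
Lemma few_forms_common_zero (K : closedFieldType) n s (g : 'I_s -> {mpoly K[n]})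
    (e : 'I_s -> nat) :
  (s < n)%N -> (forall k, g k \is (e k).-homog) -> (forall k, 0 < e k)%N ->
  exists v : 'I_n -> K, (forall k, (g k).@[v] = 0) /\ exists i, v i != 0.
Proof.
move=> ltsn g_homog e_gt0; apply: NNPP => no_zero.
have [|D nss] := homog_nullstellensatz g_homog.
  move=> v gv i; apply/eqP/negPn/negP => vi; apply: no_zero.
  by exists v; split=> //; exists i.
have {nss} nss := nss D (leqnn _).
pose gX (a : 'I_s -> nat) := \prod_k g k ^+ a k.
pose F L (t : {ffun 'I_n -> 'I_D} * {ffun 'I_s -> 'I_L}) : {mpoly K[n]} :=
  'X_[[multinom t.1 i : nat | i < n]] * gX (fun k => t.2 k).
have span L d (P : {mpoly K[n]}) (a : 'I_s -> nat) :
    (msize P <= d)%N -> (forall k, a k + d <= L)%N -> in_span (F L) (P * gX a).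
  elim: d P a => [|d IHd] P a sP aL.
    move: sP; rewrite leqn0 msize_poly_eq0 => /eqP ->.
    by rewrite mul0r; apply: in_span0.
  rewrite [P]mpolyE mulr_suml big_seq; apply: in_span_sum => m mP.
  rewrite -scalerAl; apply: in_spanZ.
  have md : (mdeg m <= d)%N by rewrite -ltnS (leq_trans _ sP) ?msize_mdeg_lt.
  have [/forallP mD|] := boolP [forall i, m i < D]%N.
    have aL' k : (a k < L)%N by have := aL k; lia.
    have -> : 'X_[m] * gX a =
        F L ([ffun i => Ordinal (mD i)], [ffun k => Ordinal (aL' k)]).
      congr ('X_[_] * _); first by apply/mnmP => i; rewrite mnmE ffunE.
      by apply: eq_bigr => k _; rewrite ffunE.
    exact: in_span_gen.
  rewrite negb_forall => /existsP [i]; rewrite -leqNgt => leDm.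
  have le_m : (U_(i) *+ D <= m)%MM.
    apply/mnm_lepP => j; rewrite mulmnE mnm1E; case: eqP => [<-|_]; by rewrite ?mul1n ?mul0n.
  have [h [sh EX]] := nss i.
  rewrite -(submK le_m) mpolyXD -mpolyXn EX mulr_sumr mulr_suml.
  apply: in_span_sum => k _.
  have -> : 'X_[m - U_(i) *+ D] * (h k * g k) * gX a =
      ('X_[m - U_(i) *+ D] * h k) * gX (fun j => a j + (j == k))%N.
    rewrite /gX -!mulrA; congr (_ * (_ * _)).
    rewrite (bigD1 k) //= [in RHS](bigD1 k) //= eqxx addn1 exprS mulrA; congr (_ * _).
    by apply: eq_bigr => j /negPf ->; rewrite addn0.
  apply: IHd => [|j]; last by have := aL j; case: (j == k) => /=; lia.
  have dm : (mdeg (m - U_(i) *+ D)%MM + D = mdeg m)%N.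
    by rewrite -[in RHS](submK le_m) mdegD mdegMn mdeg1 mul1n.
  have [->|hk0] := eqVneq (h k) 0; first by rewrite mulr0 msize0.
  have X0 : 'X_[m - U_(i) *+ D] != 0 :> {mpoly K[n]} by rewrite -msize_poly_eq0 msizeX.
  rewrite msizeM // msizeX /=.
  move: (sh k) (e_gt0 k) dm md; clear.
  move: (mdeg _) (mdeg _) (mmeasure _ _) (e k) => x y z w; lia.
(* With M ^ n monomials of degree below L <= (n + 1) M, the D ^ n * L ^ s products are too
   few, since s < n, once M exceeds D ^ n * (n + 1) ^ (n - 1). *)
pose M := (D ^ n * n.+1 ^ n.-1).+1; pose L := (n * M).+1.
pose mon (b : {ffun 'I_n -> 'I_M}) := [multinom b i : nat | i < n].
have mon_span b : in_span (F L) 'X_[mon b].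
  have -> : 'X_[mon b] = 'X_[mon b] * gX (fun=> 0%N).
    by rewrite /gX big1 ?mulr1 // => k _; rewrite expr0.
  apply: (@span _ L) => //; rewrite msizeX ltnS mdegE.
  rewrite -[n in (n * M)%N]card_ord -sum_nat_const leq_sum // => i _.
  by rewrite mnmE ltnW.
have [C EC] := fin_all_exists mon_span.
have mon_inj b b' : mon b = mon b' -> b = b'.
  move=> E; apply/ffunP => i; apply/val_inj.
  by have := congr1 (fun m : 'X_{1..n} => m i) E; rewrite /= !mnmE.
have : (#|{ffun 'I_n -> 'I_M}| <= #|{: {ffun 'I_n -> 'I_D} * {ffun 'I_s -> 'I_L}}|)%N.
  apply: (@card_le_factor_id K _ _ C (fun t b => (F L t)@_(mon b))) => b b'.
  have /(congr1 (mcoeff (mon b'))) := EC b; rewrite mcoeffX (inj_eq mon_inj) => ->.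
  by rewrite linear_sum; apply: eq_bigr => t _; rewrite /= mcoeffZ.
rewrite card_prod !card_ffun !card_ord leqNgt => /negP; apply.
have n_gt0 : (0 < n)%N by apply: leq_ltn_trans ltsn.
have leL : (L <= n.+1 * M)%N by rewrite /L mulSn addnC -addn1 leq_add2l.
have leLs : (L ^ s <= (n.+1 * M) ^ n.-1)%N.
  apply: (@leq_trans (L ^ n.-1)%N); first by rewrite leq_pexp2l // -ltnS prednK.
  by case: n.-1 => // k; rewrite leq_exp2r.
apply: leq_ltn_trans (_ : (D ^ n * (n.+1 * M) ^ n.-1 < _)%N).
  by rewrite leq_mul.
rewrite expnMn mulnA -[in ltnRHS](prednK n_gt0) expnS ltn_pmul2r ?expn_gt0 //.
Qed.

(** * Linear substitutions *)

Lemma msizeM_leq (K : idomainType) n (p q : {mpoly K[n]}) :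
  (msize (p * q) <= (msize p + msize q).-1)%N.
Proof.
have [->|p0] := eqVneq p 0; first by rewrite mul0r msize0.
have [->|q0] := eqVneq q 0; first by rewrite mulr0 msize0.
by rewrite msizeM.
Qed.

Lemma dhomog_prod_exp (R : comNzRingType) n I (r : seq I) (F : I -> {mpoly R[n]}) (e : I -> nat) :
  (forall i, F i \is 1.-homog) ->
  \prod_(i <- r) F i ^+ e i \is (\sum_(i <- r) e i)%N.-homog.
Proof.
move=> F1; elim/big_rec2: _ => [|i d p _ pd]; first exact: dhomog1.
by apply: dhomogM => //; have := dhomogMn (e i) (F1 i); rewrite mul1n.
Qed.

Lemma mderiv_homog (R : nzRingType) n d (p : {mpoly R[n]}) j :
  p \is d.-homog -> p^`M(j) \is d.-1.-homog.
Proof.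
move/dhomogP => pd; apply/dhomogP => m.
rewrite mcoeff_msupp mcoeff_deriv => nz.
have : (m + U_(j))%MM \in msupp p.
  by rewrite mcoeff_msupp; apply: contraNneq nz => ->; rewrite mul0rn.
by move/pd => /= <-; rewrite mdegD mdeg1 addn1.
Qed.

Section LinearSubstitution.

Variables (K : fieldType) (n : nat).
Implicit Types (f : {mpoly K[n.+1]}) (A B : 'M[K]_n.+1).

Lemma lin_substE f A :
  lin_subst f A = mmap (@mpolyC _ K) (fun i => \sum_j A i j *: 'X_j) f.
Proof. by apply: mmap_ext => // i; rewrite tnth_mktuple. Qed.

Lemma lin_subst_mul f A B : lin_subst (lin_subst f A) B = lin_subst f (A *m B).
Proof.
rewrite {1}lin_substE [lin_subst f A]lin_substE rmorph_mmap lin_substE.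
apply: mmap_ext => [c|i] /=; first by rewrite mmapC.
rewrite raddf_sum /=.
under eq_bigr do rewrite mmapZ mmapX mmap1U mul_mpolyC scaler_sumr.
rewrite exchange_big; apply: eq_bigr => k _.
by rewrite !mxE scaler_suml; apply: eq_bigr => j _; rewrite scalerA.
Qed.

Lemma lin_subst1 f : lin_subst f 1%:M = f.
Proof.
rewrite /lin_subst -[RHS]comp_mpoly_id; congr (_ \mPo _).
apply/eq_from_tnth => i; rewrite !tnth_mktuple (bigD1 i) //= mxE eqxx scale1r.
by rewrite big1 ?addr0 // => j /negPf ji; rewrite mxE eq_sym ji scale0r.
Qed.

Lemma meval_lin_subst f A v :
  (lin_subst f A).@[v] = f.@[fun i => \sum_j A i j * v j].
Proof.
rewrite comp_mpoly_meval; apply: meval_eq => i; rewrite tnth_mktuple raddf_sum.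
by apply: eq_bigr => j _; rewrite /= mevalZ mevalXU.
Qed.

Lemma dhomog_lin_subst d f A : f \is d.-homog -> lin_subst f A \is d.-homog.
Proof.
move/dhomogP => fd; rewrite lin_substE /mmap big_seq; apply: rpred_sum => m mf.
rewrite mul_mpolyC; apply: dhomogZ; rewrite -(fd m mf) /= mdegE.
apply: dhomog_prod_exp => i; apply: rpred_sum => j _; apply: dhomogZ.
by rewrite dhomogX; apply/eqP; apply: mdeg1.
Qed.

Lemma mderiv_lin_subst f A j :
  (lin_subst f A)^`M(j) = \sum_i A i j *: lin_subst f^`M(i) A.
Proof.
pose chain p := (lin_subst p A)^`M(j) = \sum_i A i j *: lin_subst p^`M(i) A.
have chainD p q : chain p -> chain q -> chain (p + q).
  rewrite /chain /lin_subst comp_mpolyD mderivD => -> ->; rewrite -big_split.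
  by apply: eq_bigr => i _; rewrite mderivD comp_mpolyD scalerDr.
have chainZ c p : chain p -> chain (c *: p).
  rewrite /chain /lin_subst comp_mpolyZ mderivZ => ->; rewrite scaler_sumr.
  by apply: eq_bigr => i _; rewrite mderivZ comp_mpolyZ !scalerA mulrC.
have chainM p q : chain p -> chain q -> chain (p * q).
  rewrite /chain /lin_subst rmorphM /= mderivM => -> ->.
  rewrite mulr_suml mulr_sumr -big_split; apply: eq_bigr => i _ /=.
  by rewrite mderivM comp_mpolyD !rmorphM /= scalerDr -scalerAl -scalerAr.
have chain1 : chain 1.
  rewrite /chain /lin_subst rmorph1 -mpolyC1 mderivC big1 // => i _.
  by rewrite mderivC comp_mpoly0 scaler0.
have chainX k : chain 'X_k.
  rewrite /chain lin_substE mmapX mmap1U.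
  have dX i l : ('X_i : {mpoly K[n.+1]})^`M(l) = (i == l)%:R%:MP.
    rewrite mderivX mnm1E; case: eqP => [->|_]; last by rewrite scale0r.
    by rewrite (_ : (U_(l) - U_(l) = 0)%MM) ?mpolyX0 ?scale1r //;
      apply/mnmP => x; rewrite mnmBE mnm0E subnn.
  rewrite linear_sum (bigD1 j) //= linearZ /= dX eqxx big1 => [|l /negPf lj]; last first.
    by rewrite linearZ /= dX lj mulr0n mpolyC0 scaler0.
  rewrite (bigD1 k) //= lin_substE dX eqxx mmapC addr0 big1 ?addr0 // => l /negPf lk.
  by rewrite dX eq_sym lk lin_substE mmapC mulr0n scaler0.
suff: chain f by [].
rewrite [f]mpolyE; apply: big_ind => // [|m _].
  by rewrite -[0](scale0r 1); apply: chainZ.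
apply: chainZ; rewrite mpolyXE_id; apply: big_ind => // i _.
by elim: (m i) => [|e IHe]; rewrite ?exprS //; apply: chainM.
Qed.

Lemma singular_form_lin_subst f A :
  A \in unitmx -> singular_form (lin_subst f A) -> singular_form f.
Proof.
move=> uA [x [x0 fx dfx]]; pose y := x *m A^T.
have yE i : y 0 i = \sum_j A i j * x 0 j.
  by rewrite mxE; apply: eq_bigr => j _; rewrite mxE mulrC.
exists y; split.
- apply: contraNneq x0 => y0.
  by rewrite -[x](mulmxK (_ : A^T \in unitmx)) ?unitmx_tr // -/y y0 mul0mx.
- by rewrite -fx meval_lin_subst; apply: meval_eq.
pose w := \row_i (f^`M(i)).@[y 0].
have wA : w *m A = 0.
  apply/rowP => j; rewrite !mxE -[RHS](dfx j) mderiv_lin_subst raddf_sum.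
  apply: eq_bigr => i _; rewrite /= mxE mevalZ mulrC meval_lin_subst.
  by congr (_ * _); apply: meval_eq.
move=> j; have /rowP/(_ j) : w = 0 by rewrite -[w](mulmxK uA) wA mul0mx.
by rewrite !mxE.
Qed.

Lemma lin_stab1 f : lin_stab f 1%:M.
Proof. by split; [apply: unitmx1 | apply: lin_subst1]. Qed.

Lemma lin_stabM f A B : lin_stab f A -> lin_stab f B -> lin_stab f (A *m B).
Proof.
by move=> [uA fA] [uB fB]; split; rewrite ?unitmx_mul ?uA // -lin_subst_mul fA.
Qed.

Lemma lin_stabV f A : lin_stab f A -> lin_stab f (invmx A).
Proof.
move=> [uA fA]; split; first by rewrite unitmx_inv.
by rewrite -{1}fA lin_subst_mul mulmxV // lin_subst1.
Qed.

End LinearSubstitution.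

(** * The stabilizer of a smooth form *)

(** Each coordinate satisfies a monic equation of degree D modulo polynomials of
    smaller degree, so the monomials with exponents below D span the polynomial
    functions on the set of points, and these separate points. *)
Lemma card_points_le (K : fieldType) (T : finType) M D (pt : T -> 'I_M -> K) :
  (forall t u, pt t =1 pt u -> t = u) ->
  (forall i, exists P : {mpoly K[M]}, (msize P <= D)%N /\
    forall t, pt t i ^+ D = P.@[pt t]) ->
  (#|T| <= D ^ M)%N.
Proof.
move=> pt_inj red.
pose val (P : {mpoly K[M]}) : {ffun T -> K^o} := [ffun t => P.@[pt t]].
have val_sum I (r : seq I) (Q : pred I) (c : I -> K) G :
    val (\sum_(i <- r | Q i) c i *: G i) = \sum_(i <- r | Q i) c i *: val (G i).
  apply/ffunP => t; rewrite ffunE raddf_sum sum_ffunE; apply: eq_bigr => i _.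
  by rewrite /= mevalZ !ffunE.
pose F (b : {ffun 'I_M -> 'I_D}) := val 'X_[[multinom b i : nat | i < M]].
have span d (P : {mpoly K[M]}) : (msize P <= d)%N -> in_span F (val P).
  elim: d P => [|d IHd] P sP.
    move: sP; rewrite leqn0 msize_poly_eq0 => /eqP ->.
    have -> : val 0 = 0 by apply/ffunP => t; rewrite !ffunE meval0.
    exact: in_span0.
  rewrite [P]mpolyE val_sum big_seq; apply: in_span_sum => m mP; apply: in_spanZ.
  have md : (mdeg m <= d)%N by rewrite -ltnS (leq_trans _ sP) ?msize_mdeg_lt.
  have [/forallP mD|] := boolP [forall i, m i < D]%N.
    have -> : val 'X_[m] = F [ffun i => Ordinal (mD i)].
      by congr (val 'X_[_]); apply/mnmP => i; rewrite mnmE ffunE.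
    exact: in_span_gen.
  rewrite negb_forall => /existsP [i]; rewrite -leqNgt => leDm.
  have le_m : (U_(i) *+ D <= m)%MM.
    apply/mnm_lepP => j; rewrite mulmnE mnm1E; case: eqP => [<-|_]; by rewrite ?mul1n ?mul0n.
  have [Q [sQ EQ]] := red i.
  have -> : val 'X_[m] = val ('X_[m - U_(i) *+ D] * Q).
    apply/ffunP => t; rewrite !ffunE -{1}(submK le_m) mpolyXD -mpolyXn.
    by rewrite !mevalM rmorphXn /= mevalXU EQ.
  apply: IHd; apply: leq_trans (msizeM_leq _ _) _; rewrite msizeX /=.
  have : (mdeg (m - U_(i) *+ D)%MM + D = mdeg m)%N.
    by rewrite -[in RHS](submK le_m) mdegD mdegMn mdeg1 mul1n.
  by move: sQ md; clear; move: (mdeg _) (mdeg _) (mmeasure _ _) => x y z; lia.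
have sep t u : exists P : {mpoly K[M]}, P.@[pt t] = 1 /\ (t != u -> P.@[pt u] = 0).
  have [<-|tu] := eqVneq t u; first by exists 1; rewrite meval1.
  have [i ti] : exists i, pt t i != pt u i.
    apply: NNPP => E; move/eqP: tu; apply; apply: pt_inj => i.
    by apply/eqP/negPn/negP => ?; apply: E; exists i.
  exists ((pt t i - pt u i)^-1 *: ('X_i - (pt u i)%:MP)).
  by rewrite !mevalZ !mevalB !mevalC !mevalXU subrr mulr0 mulVf ?subr_eq0 //; split.
have [S ES] := fin_all_exists (fun t => fin_all_exists (sep t)).
have delta t : in_span F (val (\prod_u S t u)) by apply: span.
have [C EC] := fin_all_exists delta.
suff : (#|T| <= #|{ffun 'I_M -> 'I_D}|)%N by rewrite card_ffun !card_ord.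
apply: (@card_le_factor_id K _ _ C (fun b t => F b t)) => t u.
have /ffunP/(_ u) := EC t; rewrite sum_ffunE ffunE => E.
transitivity ((\prod_w S t w).@[pt u]).
  by rewrite E; apply: eq_bigr => b _; rewrite !ffunE.
rewrite (rmorph_prod (meval (pt u))) /=; case: eqP => [<-|/eqP tu].
  by rewrite big1 // => w _; have [] := ES t w.
by rewrite (bigD1 u) //= (proj2 (ES t u)) ?mul0r.
Qed.

Lemma msize_comp_le (K : idomainType) n k (p : {mpoly K[n]}) (t : n.-tuple {mpoly K[k]}) :
  (forall i, (msize (tnth t i) <= 2)%N) -> (msize (p \mPo t) <= msize p)%N.
Proof.
move=> st; rewrite comp_mpolyEX; apply: leq_trans (msize_sum _ _ _) _.
apply/bigmax_leqP_seq => m mp _; apply: leq_trans (msizeZ_le _ _) _.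
apply: leq_trans (msize_mdeg_lt mp); rewrite comp_mpolyX mdegE.
elim/big_rec2: _ => [|i d q _ sq]; first by rewrite msize1.
apply: leq_trans (msizeM_leq _ _) _.
have sX : (msize (tnth t i ^+ m i) <= (m i).+1)%N.
  elim: (m i) => [|e IHe]; first by rewrite expr0 msize1.
  by rewrite exprS (leq_trans (msizeM_leq _ _)) //; move: (st i) IHe; lia.
by move: sX sq; lia.
Qed.

Lemma ex_fset_pred (T : choiceType) (P : T -> Prop) b :
  (forall s : seq T, uniq s -> (forall x, x \in s -> P x) -> (size s <= b)%N) ->
  exists G : {fset T}, forall x, x \in G <-> P x.
Proof.
move=> sb.
have [|c [s [us Ps Ec]] cmin] := @ex_minimal (fun c =>
    exists s : seq T, [/\ uniq s, forall x, x \in s -> P x & (b - size s)%N = c]).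
  by exists b, [::]; rewrite subn0.
exists [fset x in s]%fset => x; rewrite in_fset; split=> [/Ps //|Px].
apply/negPn/negP => xs; apply: (cmin (b - (size s).+1)%N).
  have := sb (x :: s); rewrite /= xs us => /(_ isT) sb'.
  suff : (size s < b)%N by rewrite -Ec; lia.
  by apply: sb' => y; rewrite inE => /orP [/eqP ->|/Ps].
exists (x :: s); rewrite /= xs us; split=> // y.
by rewrite inE => /orP [/eqP ->|/Ps].
Qed.

Section Smooth.

Variables (K : closedFieldType) (n d : nat) (f : {mpoly K[n.+1]}).
Hypotheses (d_gt2 : (2 < d)%N) (f_homog : f \is d.-homog).
Hypothesis smooth_f : ~ singular_form f.

(** The forms whose common zeros are the singular points: f, of index 0, and its partial
    derivatives. *)
Let jet (k : 'I_n.+2) : {mpoly K[n.+1]} :=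
  if unlift ord0 k is Some j then f^`M(j) else f.

Let jet0 : jet ord0 = f.
Proof. by rewrite /jet unlift_none. Qed.

Let jetS j : jet (lift ord0 j) = f^`M(j).
Proof. by rewrite /jet liftK. Qed.

Let jet_homog k : jet k \is (if k == ord0 then d else d.-1).-homog.
Proof.
case: (unliftP ord0 k) => [j ->|->]; first by rewrite jetS; apply: mderiv_homog.
by rewrite jet0.
Qed.

Let jet_no_zero (v : 'I_n.+1 -> K) : (forall k, (jet k).@[v] = 0) -> forall i, v i = 0.
Proof.
move=> jv i; apply/eqP/negPn/negP => vi; apply: smooth_f.
exists (\row_i v i); have vE : (\row_i v i) 0 =1 v by move=> j; rewrite mxE.
split.
- by apply: contraNneq vi => /rowP/(_ i); rewrite !mxE => ->.
- by rewrite (meval_eq _ vE) -jet0.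
by move=> j; rewrite (meval_eq _ vE) -jetS.
Qed.

(** Differentiating f (A x) = f x gives grad f (A x) = grad f x * A^-1. By the
    homogeneous Nullstellensatz, a power D of a coordinate of A x is a combination
    of f (A x) = f x and of the partial derivatives at A x, whose total degree in
    the entries of A and of A^-1 is at most D - (d - 1) + 1. This is less than D
    since d > 2, so the entries of A and A^-1 form a finite set of points. *)
Lemma lin_stab_finite :
  exists G : {fset 'M[K]_n.+1}, forall A, A \in G <-> lin_stab f A.
Proof.
have [D0 nss] := homog_nullstellensatz jet_homog jet_no_zero.
pose D := (D0 + d)%N; have {nss} nss := nss D (leq_addr _ _).
pose J : finType := (bool * ('I_n.+1 * 'I_n.+1))%type.
(* Points are pairs (A, A^-1); the boolean selects the matrix, so that the two cases,
   which are exchanged by A |-> A^-1, are treated at once. *)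
pose side (b : bool) (A : 'M[K]_n.+1) := if b then A else invmx A.
pose coord (A : 'M[K]_n.+1) (j : J) := side j.1 A j.2.1 j.2.2.
pose pt A (k : 'I_#|J|) := coord A (enum_val k).
pose var (j : J) : {mpoly K[#|J|]} := 'X_(enum_rank j).
have varE A j : (var j).@[pt A] = coord A j by rewrite mevalXU /pt enum_rankK.
pose base l : 'I_n.+1 -> K := fun i => (i == l)%:R.
have sideE b A l i : \sum_j side b A i j * base l j = side b A i l.
  rewrite (bigD1 l) //= /base eqxx mulr1 big1 ?addr0 // => j /negPf ->.
  by rewrite mulr0.
have grad b A l j : lin_stab f A ->
    (f^`M(j)).@[fun i => side b A i l] =
    \sum_r (f^`M(r)).@[base l] * side (~~ b) A r j.
  move=> sA; pose B := side b A.
  have sB : lin_stab f B by rewrite /B; case: (b) => //=; apply: lin_stabV.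
  have -> : side (~~ b) A = invmx B by rewrite /B; case: (b) => //=; rewrite invmxK.
  have [uB fB] := sB.
  pose w := \row_i (f^`M(i)).@[fun i => B i l].
  have wB : w *m B = \row_r (f^`M(r)).@[base l].
    apply/rowP => r; rewrite !mxE -[in RHS]fB mderiv_lin_subst raddf_sum.
    apply: eq_bigr => i _; rewrite /= mxE mevalZ mulrC meval_lin_subst.
    by congr (_ * _); apply: meval_eq => i'; rewrite sideE.
  have := mulmxK uB w; rewrite wB => /rowP/(_ j); rewrite !mxE => <-.
  by apply: eq_bigr => r _; rewrite mxE.
apply: (@ex_fset_pred _ _ (D ^ #|J|)) => s us sf.
rewrite -(card_seq_sub us).
apply: (@card_points_le _ _ _ _ (fun t : seq_sub s => pt (val t))).
  move=> t u tu; apply/val_inj/matrixP => i l.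
  by have := tu (enum_rank (true, (i, l))); rewrite /pt enum_rankK.
move=> k; pose j := enum_val k; pose b := j.1; pose l := j.2.2.
have [h [sh EX]] := nss j.2.1.
pose col := [tuple var (b, (i, l)) | i < n.+1].
pose rhs k : {mpoly K[#|J|]} := if unlift ord0 k is Some i
  then \sum_r (f^`M(r)).@[base l] *: var (~~ b, (r, i)) else (f.@[base l])%:MP.
exists (\sum_k (h k \mPo col) * rhs k); split.
  apply: leq_trans (msize_sum _ _ _) _; apply/bigmax_leqP_seq => q _ _.
  have s1 : (msize (h q \mPo col) <= msize (h q))%N.
    by apply: msize_comp_le => i; rewrite tnth_mktuple msizeX mdeg1.
  apply: leq_trans (msizeM_leq _ _) _; move: s1 (sh q).
  have leD : (d <= D)%N by rewrite leq_addl.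
  rewrite /rhs; case: (unliftP ord0 q) => [i|] -> /=.
    have s2 : (msize (\sum_r (f^`M(r)).@[base l] *: var (~~ b, (r, i))) <= 2)%N.
      apply: leq_trans (msize_sum _ _ _) _; apply/bigmax_leqP_seq => r _ _.
      by rewrite (leq_trans (msizeZ_le _ _)) // msizeX mdeg1.
    move: s2 leD d_gt2.
    by move: (mmeasure _ _) (mmeasure _ (_ \mPo _)) (mmeasure _ _) (D) => x y z w; lia.
  have s2 : (msize (f.@[base l])%:MP_[#|J|] <= 1)%N by rewrite msizeC leq_b1.
  move: s2 leD d_gt2.
  by move: (mmeasure _ _) (mmeasure _ (_ \mPo _)) (mmeasure _ _) (D) => x y z w; lia.
move=> [A As] /=; have sA := sf A As.
have colE p : (p \mPo col).@[pt A] = p.@[fun i => side b A i l].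
  by rewrite comp_mpoly_meval; apply: meval_eq => i; rewrite tnth_mktuple varE.
rewrite -[pt A k]/(side b A j.2.1 l).
have /(congr1 (meval (fun i => side b A i l))) := EX.
rewrite rmorphXn /= mevalXU => ->.
rewrite !raddf_sum; apply: eq_bigr => q _ /=; rewrite !mevalM colE; congr (_ * _).
rewrite /rhs; case: (unliftP ord0 q) => [i|] -> /=.
  rewrite jetS (grad _ _ _ _ sA) raddf_sum; apply: eq_bigr => r _ /=.
  by rewrite mevalZ varE.
rewrite jet0 mevalC.
have sB : lin_stab f (side b A) by rewrite /side; case: (b) => //=; apply: lin_stabV.
rewrite -{2}(proj2 sB) meval_lin_subst.
by apply: meval_eq => i; rewrite sideE.
Qed.

(** On the eigenspace of mu only the partial derivatives along the eigenspace of
    mu ^ (1 - d) can be nonzero, and f itself vanishes there unless these two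
    eigenspaces coincide. They have a common zero if they are too few. *)
Lemma diag_stab_eigenvalues (lam : 'rV[K]_n.+1) (mu : K) :
  lin_stab f (diag_mx lam) -> mu != 0 ->
  (#|[set i | lam ord0 i == mu]| <= #|[set i | (lam ord0 i * mu ^+ d.-1)%R == 1%R]|)%N.
Proof.
move=> [_ flam] mu0; set I := [set i | lam ord0 i == mu]; set J := [set i | _].
have d_gt0 : (0 < d)%N by apply: leq_trans d_gt2.
rewrite leqNgt; apply/negP => ltJI.
have coef_f (m : 'X_{1..n.+1}) : \prod_i lam ord0 i ^+ m i != 1 -> f@_m = 0.
  move=> nm; have /(congr1 (mcoeff m)) := flam; rewrite lin_substE /mmap.
  have mono k : mmap1 (fun i => \sum_j (diag_mx lam) i j *: 'X_j) k =
      (\prod_i lam ord0 i ^+ k i) *: 'X_[k] :> {mpoly K[n.+1]}.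
    rewrite /mmap1 [in RHS]mpolyXE_id -scaler_prod; apply: eq_bigr => i _.
    rewrite -exprZn (bigD1 i) //= mxE eqxx mulr1n big1 ?addr0 // => j /negPf ij.
    by rewrite mxE eq_sym ij mulr0n scale0r.
  rewrite linear_sum /=; under eq_bigr do rewrite mono mul_mpolyC scalerA mcoeffZ mcoeffX.
  have [mf|/memN_msupp_eq0 -> //] := boolP (m \in msupp f).
  rewrite (bigD1_seq m) ?msupp_uniq //= eqxx mulr1 [X in _ + X]big1 ?addr0 => [|k /negPf ->].
    by move/eqP; rewrite -subr_eq0 -[X in _ - X]mulr1 -mulrBr mulf_eq0 subr_eq0 (negPf nm) orbF => /eqP.
  by rewrite mulr0.
(* A common zero of the partial derivatives indexed by J and of the coordinates outside I
   is a point of the eigenspace of mu where all partial derivatives vanish. *)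
pose idx : finType := ({i | i \in J} + {i | i \notin I})%type.
pose form (t : idx) : {mpoly K[n.+1]} :=
  match t with inl j => f^`M(val j) | inr i => 'X_(val i) end.
pose e (t : idx) := if t is inl _ then d.-1 else 1%N.
have lt_idx : (#|idx| < n.+1)%N.
  rewrite card_sum !card_sig.
  have -> : #|[pred i | i \in J]| = #|J| by apply: eq_card.
  have -> : #|[pred i | i \notin I]| = #|[predC I]| by apply: eq_card.
  apply: (@leq_trans (#|I| + #|[predC I]|)); last by rewrite cardC card_ord.
  by rewrite -addSn leq_add2r.
have [|k|v [v0 [i vi]]] := @few_forms_common_zero K n.+1 _ (fun k => form (enum_val k))
    (fun k => e (enum_val k)) lt_idx.
- move=> k; case: (enum_val k) => [j|i] /=; first exact: mderiv_homog.
  by rewrite dhomogX; apply/eqP; apply: mdeg1.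
- by case: (enum_val k) => //= _; lia.
have form0 t : (form t).@[v] = 0 by rewrite -[t]enum_rankK.
have vI j : j \notin I -> v j = 0.
  by move=> jI; have := form0 (inr (exist _ j jI)); rewrite /= mevalXU.
apply: smooth_f; exists (\row_i v i).
have vE : (\row_i v i) 0 =1 v by move=> j; rewrite mxE.
have supp (m : 'X_{1..n.+1}) : (exists2 j, m j != 0%N & v j == 0) -> \prod_j v j ^+ m j = 0.
  case=> j mj /eqP vj; rewrite (bigD1 j) //= vj expr0n (negPf mj) mul0r //.
have lamI (m : 'X_{1..n.+1}) : (forall j, m j != 0%N -> v j != 0) -> \prod_j lam ord0 j ^+ m j = mu ^+ mdeg m.
  move=> mI; rewrite mdegE -prodrXr; apply: eq_bigr => j _.
  have [->|/mI vj] := eqVneq (m j) 0%N; first by rewrite !expr0.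
  have : j \in I by apply: contraNT vj => /vI ->.
  by rewrite inE => /eqP ->.
have splitm (m : 'X_{1..n.+1}) :
    (exists2 j, m j != 0%N & v j == 0) \/ (forall j, m j != 0%N -> v j != 0).
  have [/existsP [j /andP[mj vj]]|] := boolP [exists j, (m j != 0%N) && (v j == 0)].
    by left; exists j.
  rewrite negb_exists => /forallP H; right => j mj.
  by have := H j; rewrite mj.
split.
- by apply: contraNneq vi => /rowP/(_ i); rewrite !mxE => ->.
- rewrite (meval_eq _ vE) mevalE big_seq big1 // => m mf.
  have [/supp ->|mI] := splitm m; first by rewrite mulr0.
  rewrite coef_f ?mul0r // lamI //.
  have := dhomogP _ _ _ f_homog => -> //=.
  apply: contraTneq ltJI => mud; rewrite -leqNgt subset_leq_card //.
  apply/subsetP => j; rewrite !inE => /eqP ->.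
  by rewrite -exprS prednK // mud.
move=> j; rewrite (meval_eq _ vE).
have [jJ|jJ] := boolP (j \in J); first exact: (form0 (inl (exist _ j jJ))).
rewrite mevalE big_seq big1 // => m mf.
have [/supp ->|mI] := splitm m; first by rewrite mulr0.
rewrite mcoeff_deriv coef_f ?mul0rn ?mul0r //.
under eq_bigr do rewrite mnmDE exprD.
rewrite big_split /= lamI // (dhomogP _ _ _ (mderiv_homog j f_homog)) //=.
rewrite (bigD1 j) //= mnm1E eqxx expr1 big1 ?mulr1 => [|k /negPf kj].
  by move: jJ; rewrite inE mulrC.
by rewrite mnm1E eq_sym kj expr0.
Qed.

End Smooth.

(** * Brauer characters of nilpotent groups *)

Lemma diag_of_rows (F : fieldType) m (P A : 'M[F]_m) (v : 'rV[F]_m) :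
  (forall i, row i P *m A = v 0 i *: row i P) -> P *m A = diag_mx v *m P.
Proof.
move=> PA; apply/row_matrixP => i; rewrite row_mul PA; apply/rowP => j.
by rewrite mul_diag_mx !mxE.
Qed.

Lemma eq_mxtens m1 m2 (i j : 'I_(m1 * m2)) :
  (i == j) = ((mxtens_unindex i).1 == (mxtens_unindex j).1) &&
             ((mxtens_unindex i).2 == (mxtens_unindex j).2).
Proof.
rewrite -(inj_eq (can_inj (@mxtens_unindexK m1 m2))).
by rewrite -[LHS]/((_, _) == (_, _)) xpair_eqE.
Qed.

Section Lift.

Variables (K : closedFieldType) (E : nat) (omega : K) (zeta : algC).
Hypotheses (prim_omega : E.-primitive_root omega) (prim_zeta : E.-primitive_root zeta).

(** The isomorphism between the E-th roots of unity of K and of algC. It is extended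
    by 0, so that it is also multiplicative on the eigenvalues of singular matrices. *)
Definition root_lift (x : K) : algC :=
  if [pick i : 'I_E | omega ^+ i == x] is Some i then zeta ^+ i else 0.

Lemma root_liftX k : root_lift (omega ^+ k) = zeta ^+ k.
Proof.
rewrite /root_lift; case: pickP => [i|].
  rewrite (eq_prim_root_expr prim_omega) -(eq_prim_root_expr prim_zeta).
  by move/eqP.
have E_gt0 := prim_order_gt0 prim_omega.
move/(_ (Ordinal (ltn_pmod k E_gt0))) => /=.
by rewrite (prim_expr_mod prim_omega) eqxx.
Qed.

Lemma root_lift1 : root_lift 1 = 1.
Proof. by rewrite -(expr0 omega) root_liftX. Qed.

Lemma root_lift0 : root_lift 0 = 0.
Proof.
rewrite /root_lift; case: pickP => // i; rewrite expf_eq0 => /andP [_ /eqP o0].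
have := prim_expr_order prim_omega.
by rewrite o0 expr0n (gtn_eqF (prim_order_gt0 prim_omega)) => /eqP; rewrite eq_sym oner_eq0.
Qed.

Lemma root_liftM x y : x ^+ E = 1 -> y ^+ E = 1 ->
  root_lift (x * y) = root_lift x * root_lift y.
Proof.
move=> /(prim_rootP prim_omega) [i ->] /(prim_rootP prim_omega) [j ->].
by rewrite -exprD !root_liftX exprD.
Qed.

Lemma root_lift_root x : x ^+ E = 1 -> root_lift x ^+ E = 1.
Proof.
move/(prim_rootP prim_omega) => [i ->].
by rewrite root_liftX exprAC (prim_expr_order prim_zeta) expr1n.
Qed.

Lemma root_lift_inj x y : x ^+ E = 1 -> y ^+ E = 1 ->
  root_lift x = root_lift y -> x = y.
Proof.
move=> /(prim_rootP prim_omega) [i ->] /(prim_rootP prim_omega) [j ->] /eqP.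
by rewrite !root_liftX (eq_prim_root_expr prim_zeta) -(eq_prim_root_expr prim_omega) => /eqP.
Qed.

Lemma root_lift_eq1 x : x ^+ E = 1 -> root_lift x = 1 -> x = 1.
Proof.
by move=> xE; rewrite -root_lift1; apply: root_lift_inj; rewrite ?expr1n.
Qed.

Definition brauer_trace m (A : 'M[K]_m) : algC :=
  \sum_(z <- sval (closed_field_poly_normal (char_poly A))) root_lift z.

Lemma brauer_trace_char_poly m (A : 'M[K]_m) s :
  char_poly A = \prod_(z <- s) ('X - z%:P) ->
  brauer_trace A = \sum_(z <- s) root_lift z.
Proof.
rewrite /brauer_trace; case: closed_field_poly_normal => t /= ->.
rewrite (monicP (char_poly_monic A)) scale1r => /prod_XsubC_eq ts.
exact: perm_big.
Qed.

Lemma char_poly_similar m (P A B : 'M[K]_m) :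
  P \in unitmx -> P *m A = B *m P -> char_poly A = char_poly B.
Proof.
move=> uP PA; pose P' := map_mx polyC P.
have dP : \det P' != 0 by rewrite det_map_mx polyC_eq0 -unitfE -unitmxE.
apply: (mulfI dP); rewrite [RHS]mulrC -!det_mulmx; congr (\det _).
by rewrite mulmxBr mulmxBl -!map_mxM PA scalar_mxC.
Qed.

Lemma brauer_trace_diag m (P A : 'M[K]_m) v :
  P \in unitmx -> P *m A = diag_mx v *m P ->
  brauer_trace A = \sum_i root_lift (v 0 i).
Proof.
move=> uP PA; rewrite -(big_map (fun i => v 0 i) predT root_lift).
apply: brauer_trace_char_poly; rewrite (char_poly_similar uP PA).
rewrite char_poly_trig ?diag_mx_is_trig // big_map.
by apply: eq_bigr => i _; rewrite mxE eqxx mulr1n.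
Qed.

Lemma brauer_trace_block m1 m2 (A : 'M[K]_m1) (B : 'M[K]_m2) :
  brauer_trace (block_mx A 0 0 B) = brauer_trace A + brauer_trace B.
Proof.
rewrite {2 3}/brauer_trace.
case: closed_field_poly_normal => s /= Es; case: closed_field_poly_normal => t /= Et.
rewrite -big_cat; apply: brauer_trace_char_poly.
rewrite (monicP (char_poly_monic _)) scale1r in Es.
rewrite (monicP (char_poly_monic _)) scale1r in Et.
by rewrite /char_poly char_block_diag_mx det_ublock big_cat -Es -Et.
Qed.

Lemma brauer_trace_tens m1 m2 (A : 'M[K]_m1) (B : 'M[K]_m2) P Q u v :
  P \in unitmx -> P *m A = diag_mx u *m P -> (forall i, u 0 i ^+ E = 1) ->
  Q \in unitmx -> Q *m B = diag_mx v *m Q -> (forall i, v 0 i ^+ E = 1) ->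
  brauer_trace (A *t B) = brauer_trace A * brauer_trace B.
Proof.
move=> uP PA uE uQ QB vE.
pose w := \row_k (u 0 (mxtens_unindex k).1 * v 0 (mxtens_unindex k).2).
have dw : diag_mx u *t diag_mx v = diag_mx w.
  apply/matrixP => i j; rewrite !mxE eq_mxtens.
  by case: eqP => _; case: eqP => _; rewrite ?mulr1n ?mulr0n ?mulr0 ?mul0r.
have uPQ : P *t Q \in unitmx.
  suff : (P *t Q) *m (invmx P *t invmx Q) = 1%:M by case/mulmx1_unit.
  rewrite tensmx_mul !mulmxV //; apply/matrixP => i j; rewrite !mxE eq_mxtens.
  by rewrite -natrM mulnb.
have := brauer_trace_diag uPQ; move/(_ (A *t B) w) => ->; last first.
  by rewrite -dw !tensmx_mul PA QB.
rewrite (brauer_trace_diag uP PA) (brauer_trace_diag uQ QB) big_distrlr pair_big /=.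
rewrite (reindex (@mxtens_index m1 m2)) /=; last first.
  by exists (@mxtens_unindex m1 m2) => x _; [apply: mxtens_indexK | apply: mxtens_unindexK].
apply: eq_bigr => ij _; rewrite mxE root_liftM //.
by rewrite mxtens_indexK.
Qed.

(** A matrix killed by X^(E+1) - X is diagonalizable, as this polynomial splits
    without multiple root. *)
Lemma expS_diagonalizable m (A : 'M[K]_m) : A ^+ E.+1 = A -> diagonalizable A.
Proof.
case: m A => [|m] A AE; first by rewrite thinmx0; apply: diagonalizable0.
have E_gt0 := prim_order_gt0 prim_omega.
have om0 : omega != 0.
  by apply: contra_eq_neq (prim_expr_order prim_omega) => ->; rewrite expr0n gtn_eqF // eq_sym oner_neq0.
apply/diagonalizableP; exists (0 :: [seq omega ^+ i | i <- index_iota 0 E]).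
  rewrite /= andbC map_inj_in_uniq ?iota_uniq /=; last first.
    move=> i j; rewrite !mem_index_iota /= => ltiE ltjE /eqP.
    by rewrite (eq_prim_root_expr prim_omega) !modn_small // => /eqP.
  by apply/mapP => -[i _ /eqP]; rewrite eq_sym expf_eq0 (negPf om0) andbF.
rewrite big_cons big_map (factor_Xn_sub_1 prim_omega) subr0 mulrBr mulr1 -exprS.
by rewrite mxminpoly_min // rmorphB rmorphXn /= horner_mx_X AE subrr.
Qed.

End Lift.

Section Average.

Variables (K : closedFieldType) (gT : finGroupType) (L : {group gT}).
Variables (omega : K) (zeta : algC).
Hypotheses (prim_omega : #|L|.-primitive_root omega) (prim_zeta : #|L|.-primitive_root zeta).
Hypothesis nilL : nilpotent L.

Let lift := root_lift #|L| omega zeta.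

Let lift0 : lift 0 = 0 := root_lift0 zeta prim_omega.

Let card_neq0 (H : {group gT}) : H \subset L -> #|H|%:R != 0 :> K.
Proof. by move/cardSg; apply: (prim_root_dvd_eq0 prim_omega). Qed.

(** Orthogonality: a nontrivial character of H sums to 0, before and after lifting. *)
Lemma sum_root_lift (H : {group gT}) (chi : gT -> K) xi :
  H \subset L -> (xi = 0 \/ xi ^+ #|L| = 1) ->
  {in H &, {morph chi : x y / (x * y)%g >-> x * y}} ->
  (forall h, h \in H -> chi h ^+ #|L| = 1) ->
  \sum_(h in H) lift (xi * chi h) =
    #|H|%:R * lift (xi * (#|H|%:R^-1 * \sum_(h in H) chi h)).
Proof.
move=> sHL xiL chiM chiL; have H0 := card_neq0 sHL.
have [->|xi0] := eqVneq xi 0.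
  by rewrite mul0r lift0 mulr0 big1 // => h _; rewrite mul0r lift0.
have {}xiL : xi ^+ #|L| = 1 by case: xiL => // /eqP; rewrite (negPf xi0).
have [/forall_inP chi1|] := boolP [forall h in H, chi h == 1].
  have E h : h \in H -> chi h = 1 by move/chi1/eqP.
  rewrite (eq_bigr _ E) sumr_const mulVf // mulr1.
  by rewrite (eq_bigr (fun=> lift xi)) => [|h /E ->]; rewrite ?mulr1 // sumr_const mulr_natl.
rewrite negb_forall_in => /exists_inP [h0 Hh0 chi_h0].
have shift (R : nmodType) (F : gT -> R) : \sum_(h in H) F h = \sum_(h in H) F (h0 * h)%g.
  rewrite (reindex_inj (mulgI h0)) /=; apply: eq_bigl => h.
  by rewrite groupMl.
have sum_chi : \sum_(h in H) chi h = 0.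
  have : \sum_(h in H) chi h = chi h0 * \sum_(h in H) chi h.
    by rewrite [LHS]shift mulr_sumr; apply: eq_bigr => h Hh; rewrite chiM.
  move/eqP; rewrite -subr_eq0 -[X in X - _]mul1r -mulrBl mulf_eq0 subr_eq0 eq_sym.
  by rewrite (negPf chi_h0) => /eqP.
rewrite sum_chi !mulr0 lift0 mulr0.
have liftM h : h \in H -> lift (xi * chi h) = lift xi * lift (chi h).
  by move=> Hh; apply: root_liftM => //; apply: chiL.
rewrite (eq_bigr _ liftM) -mulr_sumr.
have : \sum_(h in H) lift (chi h) = lift (chi h0) * \sum_(h in H) lift (chi h).
  rewrite [LHS]shift mulr_sumr; apply: eq_bigr => h Hh; rewrite chiM //.
  by apply: root_liftM => //; apply: chiL.
move/eqP; rewrite -subr_eq0 -[X in X - _]mul1r -mulrBl mulf_eq0 subr_eq0 eq_sym.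
case/orP => [/eqP/(root_lift_eq1 prim_omega prim_zeta (chiL _ Hh0))/eqP|/eqP ->].
  by rewrite (negPf chi_h0).
by rewrite mulr0.
Qed.

Variables (m : nat) (r : gT -> 'M[K]_m).
Hypothesis r_repr : mx_repr L r.

Definition group_average (H : {set gT}) : 'M[K]_m :=
  #|H|%:R^-1 *: \sum_(h in H) r h.

Let tr := @brauer_trace K #|L| omega zeta m.

Let rM : {in L &, {morph r : x y / (x * y)%g >-> x *m y}} := proj2 r_repr.

(** The eigenvalues of commuting diagonalizable matrices are characters, so the sum
    over H can be evaluated eigenvector by eigenvector. The two sides only see the
    image of the average over [H, L], on which H acts centrally; this commutator is
    smaller than H as L is nilpotent. *)
Lemma sum_brauer_trace_coset (H : {group gT}) x : (H <| L)%g -> x \in L ->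
  \sum_(h in H) tr (r (x * h)%g) = #|H|%:R * tr (r x *m group_average H).
Proof.
have [k] := ubnP #|H|; elim: k H x => // k IHk H x; rewrite ltnS => leHk nsHL Lx.
have [sHL nHL] := andP nsHL.
have inL h : h \in H -> h \in L := fun Hh => subsetP sHL h Hh.
have [H1|ntH] := eqVneq (H : {set gT}) 1%g.
  rewrite /group_average H1 !big_set1 cards1 invr1 scale1r mulg1 mul1r.
  by rewrite (proj1 r_repr) mulmx1.
pose Q := [~: H, L]%G.
have prQH : Q \proper H.
  by apply: nil_comm_properl nilL sHL ntH _; rewrite subsetI subxx.
have sQH := proper_sub prQH.
have nsQL : (Q <| L)%g by rewrite /normal (subset_trans sQH sHL) /= commg_normr.
have inQ q : q \in Q -> q \in L := fun Qq => inL q (subsetP sQH q Qq).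
have Q0 := card_neq0 (subset_trans sQH sHL).
pose e := group_average Q.
have e_absorb q : q \in Q -> r q *m e = e.
  move=> Qq; rewrite /e /group_average -scalemxAr mulmx_sumr; congr (_ *: _).
  rewrite [RHS](reindex_inj (mulgI q)) /=.
  by apply: eq_big => [h|h Qh]; rewrite ?groupMl // rM ?(inQ q) ?(inQ h).
have e_comm g : g \in L -> r g *m e = e *m r g.
  move=> Lg; rewrite /e /group_average -scalemxAr -scalemxAl mulmx_sumr mulmx_suml.
  have gI : injective (fun h : gT => (h ^ g)%g) by apply: conjg_inj.
  congr (_ *: _); rewrite [LHS](reindex_inj gI) /=.
  have nQg := subsetP (normal_norm nsQL) g Lg.
  apply: eq_big => [h|h Qh]; first by rewrite memJ_norm.
  have Lhg := inQ _ Qh; rewrite memJ_norm // in Qh.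
  by rewrite -!rM ?(inQ h) // (conjgC h g).
have e_idem : e *m e = e.
  rewrite {1}/e /group_average -scalemxAl mulmx_suml (eq_bigr _ e_absorb).
  by rewrite sumr_const -scaler_nat scalerA mulVf // scale1r.
have step1 : \sum_(h in H) tr (r (x * h)%g) = \sum_(h in H) tr (r (x * h)%g *m e).
  have Q0C : #|Q|%:R != 0 :> algC by rewrite Num.Theory.pnatr_eq0 -lt0n cardG_gt0.
  apply: (mulfI Q0C); rewrite [RHS]mulr_sumr.
  transitivity (\sum_(h in H) \sum_(q in Q) tr (r (x * h * q)%g)).
    rewrite exchange_big /= -[#|Q|%:R]/(#|Q|%:R) mulr_natl -sumr_const.
    apply: eq_bigr => q Qq; rewrite [LHS](reindex_inj (mulIg q)) /=.
    apply: eq_big => [h|h _]; last by rewrite mulgA.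
    by rewrite groupMr // (subsetP sQH).
  apply: eq_bigr => h Hh; apply: IHk => //; last by apply: groupM => //; apply: inL.
  exact: leq_trans (proper_card prQH) leHk.
have rMe g g' : g \in L -> g' \in L -> (r g *m e) *m (r g' *m e) = r (g * g')%g *m e.
  move=> Lg Lg'; rewrite -!mulmxA [e *m _]mulmxA -e_comm //.
  by rewrite !mulmxA -rM // -mulmxA e_idem.
have central g h : g \in L -> h \in H -> r (g * h)%g *m e = r (h * g)%g *m e.
  move=> Lg Hh; have -> : (g * h = h * g * [~ g, h])%g.
    by rewrite commgEl -mulgA mulKVg (conjgC g h).
  have Qc : [~ g, h]%g \in Q by rewrite -groupV invg_comm mem_commg.
  by rewrite rM ?(inQ _ Qc) ?groupM ?(inL h) // -mulmxA e_absorb.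
have expE g j : g \in L -> (r g *m e) ^+ j.+1 = r (g ^+ j.+1)%g *m e.
  move=> Lg; elim: j => [|j IHj]; first by rewrite expr1 expg1.
  by rewrite exprS IHj -[_ * _]/(_ *m _) rMe ?groupX // -expgS.
have expL g : g \in L -> (r g *m e) ^+ #|L|.+1 = r g *m e.
  by move=> Lg; rewrite expE // expgS expg_cardG // mulg1.
pose As := (r x *m e) :: [seq r h *m e | h <- enum H].
have [P uP /allP diagAs] : codiagonalizable As.
  apply/codiagonalizableP; split; last first.
    move=> A; rewrite inE => /orP [/eqP ->|/mapP [h]].
      exact: (expS_diagonalizable prim_omega (expL x Lx)).
    rewrite mem_enum => Hh ->; exact: (expS_diagonalizable prim_omega (expL h (inL h Hh))).
  have commHe g h : g \in L -> h \in H -> comm_mx (r g *m e) (r h *m e).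
    by move=> Lg Hh; have Lh := inL h Hh; rewrite /comm_mx !rMe // central.
  move=> A B; rewrite !inE => /orP [/eqP ->|/mapP [h]]; last rewrite mem_enum => Hh ->;
    (case/orP => [/eqP ->|/mapP [h' + ->]]; last rewrite mem_enum => Hh') => //.
  - exact: commHe.
  - exact/comm_mx_sym/commHe.
  - exact: commHe (inL _ Hh) Hh'.
(* From here on each row w i of P is a common eigenvector: w i *m A = phi i A *: w i. *)
pose w i := row i P.
have w_cancel i a b : a *: w i = b *: w i -> a = b.
  move/eqP; rewrite -subr_eq0 -scalerBl scaler_eq0 subr_eq0 => /orP [/eqP //|].
  move=> w0; have /rowP/(_ i) : row i (P *m invmx P) = 0 by rewrite row_mul -/(w i) (eqP w0) mul0mx.
  by rewrite mulmxV // !mxE eqxx => /eqP; rewrite oner_eq0.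
pose phi i A := (P *m A *m invmx P) i i.
have PA A : A \in As -> P *m A = diag_mx (\row_i phi i A) *m P.
  move=> AAs; have /diagonalizable_forPex [u /(simmxP uP) Eu] := diagAs A AAs.
  rewrite [LHS]Eu; congr (diag_mx _ *m P); apply/rowP => i.
  by rewrite mxE /phi Eu mulmxK // mxE eqxx mulr1n.
have wA i A : A \in As -> w i *m A = phi i A *: w i.
  move=> AAs; rewrite -row_mul PA //; apply/rowP => j.
  by rewrite mxE mul_diag_mx !mxE.
have phi_pow i A : A \in As -> A ^+ #|L|.+1 = A -> phi i A ^+ #|L|.+1 = phi i A.
  move=> AAs AE; apply: (w_cancel i); rewrite -wA // -[in RHS]AE.
  elim: #|L|.+1 => [|j IHj]; first by rewrite !expr0 scale1r -[1]/(1%:M) mulmx1.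
  by rewrite !exprSr -[_ * A]/(_ *m A) mulmxA -IHj -scalemxAl wA // scalerA.
have XAs : r x *m e \in As by rewrite inE eqxx.
have hAs h : h \in H -> r h *m e \in As.
  by move=> Hh; rewrite inE; apply/orP; right; apply: map_f; rewrite mem_enum.
pose xi i := phi i (r x *m e); pose chi i h := phi i (r h *m e).
have chiM i : {in H &, {morph chi i : h h' / (h * h')%g >-> h * h'}}.
  move=> h h' Hh Hh'; apply: (w_cancel i); rewrite /chi -scalerA.
  rewrite -(wA i _ (hAs _ Hh')) -(wA i _ (hAs _ (groupM Hh Hh'))) scalemxAl.
  by rewrite -(wA i _ (hAs _ Hh)) -mulmxA rMe ?(inL h) ?(inL h').
have avgE : r x *m group_average H =
    (r x *m e) *m (#|H|%:R^-1 *: \sum_(h in H) r h *m e).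
  have -> : \sum_(h in H) r h *m e = e *m \sum_(h in H) r h.
    by rewrite mulmx_sumr; apply: eq_bigr => h Hh; rewrite e_comm ?(inL h).
  rewrite -mulmxA; congr (_ *m _); rewrite -scalemxAr mulmxA e_idem.
  rewrite {1}/group_average; congr (_ *: _); rewrite /e /group_average -scalemxAl mulmx_suml.
  set S := \sum_(h in H) r h.
  have -> : \sum_(q in Q) r q *m S = S *+ #|Q|.
    rewrite -sumr_const; apply: eq_bigr => q Qq; rewrite /S mulmx_sumr.
    rewrite [RHS](reindex_inj (mulgI q)) /=.
    have Hq := subsetP sQH q Qq.
    by apply: eq_big => [h|h Hh]; rewrite ?groupMl // rM ?(inL q) ?(inL h).
  by rewrite -[X in _ *: X]scaler_nat scalerA mulVf // scale1r.
rewrite step1 avgE /tr; clear step1 avgE e_absorb; clearbody e.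
rewrite (eq_bigr (fun h => \sum_i lift (xi i * chi i h))) => [|h Hh].
  rewrite (@brauer_trace_diag _ _ _ _ _ _ _
      (\row_i (xi i * (#|H|%:R^-1 * \sum_(h in H) chi i h))) uP).
    rewrite exchange_big mulr_sumr; apply: eq_bigr => i _; rewrite mxE -/lift.
    have xiL : xi i = 0 \/ xi i ^+ #|L| = 1.
      have /eqP := phi_pow i _ XAs (expL x Lx); rewrite -/(xi i) exprSr.
      rewrite -subr_eq0 -[X in _ - X]mul1r -mulrBl mulf_eq0 subr_eq0 orbC.
      by case/orP => /eqP; [left | right].
    (* chi i 1 is the eigenvalue of e, which is zero off the image of e. *)
    have [chi1|chi1] := eqVneq (chi i 1%g) 0.
      have chi0 h : h \in H -> chi i h = 0.
        by move=> Hh; rewrite -[h]mulg1 chiM ?group1 // chi1 mulr0.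
      rewrite [X in _ * (_ * X)]big1 // !mulr0 lift0 mulr0 big1 // => h Hh.
      by rewrite chi0 // mulr0 lift0.
    apply: sum_root_lift => // h Hh.
    have /eqP := phi_pow i _ (hAs h Hh) (expL h (inL h Hh)); rewrite -/(chi i h) exprSr.
    rewrite -subr_eq0 -[X in _ - X]mul1r -mulrBl mulf_eq0 subr_eq0.
    case/orP => /eqP // chih; case/eqP: chi1.
    by rewrite -(mulgV h) chiM ?groupV // chih mul0r.
  apply: diag_of_rows => i; rewrite -/(w i) mulmxA wA // -scalemxAl -scalemxAr.
  rewrite mulmx_sumr (eq_bigr (fun h => chi i h *: w i)) => [|h Hh]; last by rewrite wA ?hAs.
  by rewrite -scaler_suml !scalerA mxE mulrA.
have -> : r (x * h)%g *m e = (r x *m e) *m (r h *m e) by rewrite rMe ?(inL h).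
rewrite (@brauer_trace_diag _ _ _ _ _ _ _ (\row_i (xi i * chi i h)) uP).
  by apply: eq_bigr => i _; rewrite mxE.
apply: diag_of_rows => i.
rewrite -/(w i) (mulmxA (w i)) (wA i _ XAs) -scalemxAl (wA i _ (hAs h Hh)).
by rewrite scalerA mxE.
Qed.

End Average.

Section VirtualCharacters.

Variables (K : closedFieldType) (gT : finGroupType) (L : {group gT}).
Variables (omega : K) (zeta : algC).
Hypotheses (prim_omega : #|L|.-primitive_root omega) (prim_zeta : #|L|.-primitive_root zeta).

Let lift := root_lift #|L| omega zeta.

Lemma repr_diag m (r : gT -> 'M[K]_m) g : mx_repr L r -> g \in L ->
  exists P v, [/\ P \in unitmx, P *m r g = diag_mx v *m P & forall i, v 0 i ^+ #|L| = 1].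
Proof.
move=> [r1 rM] Lg.
have rX j : r g ^+ j = r (g ^+ j)%g.
  elim: j => [|j IHj]; first by rewrite expr0 expg0 r1.
  by rewrite exprS IHj expgS rM ?groupX.
have rL : r g ^+ #|L| = 1 by rewrite rX expg_cardG.
have [|P uP] := @expS_diagonalizable _ _ _ prim_omega _ (r g).
  by rewrite exprS rL mulr1.
move=> /diagonalizable_forPex [v /(simmxP uP) Ev]; exists P, v; split=> // i.
have powv j : P *m r g ^+ j = diag_mx (\row_i v 0 i ^+ j) *m P.
  elim: j => [|j IHj].
    rewrite expr0 -[1]/(1%:M) mulmx1 -[LHS]mul1mx; congr (_ *m P).
    by apply/matrixP => a b; rewrite !mxE expr0.
  rewrite exprSr -[_ * _]/(_ *m _) mulmxA IHj -mulmxA Ev mulmxA; congr (_ *m P).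
  by rewrite mulmx_diag; congr diag_mx; apply/rowP => a; rewrite !mxE exprSr.
have /(congr1 (fun A => A *m invmx P)) := powv #|L|.
rewrite rL -[1]/(1%:M) mulmx1 mulmxK // mulmxV // => /matrixP/(_ i i).
by rewrite !mxE eqxx !mulr1n => <-.
Qed.

Definition brauer_char (phi : gT -> algC) := exists m (r : gT -> 'M[K]_m),
  mx_repr L r /\ {in L, forall g, phi g = brauer_trace #|L| omega zeta (r g)}.

Definition virtual_char (phi : gT -> algC) := exists a b,
  [/\ brauer_char a, brauer_char b & {in L, forall g, phi g = a g - b g}].

Lemma virtual_char_ext phi psi :
  {in L, phi =1 psi} -> virtual_char phi -> virtual_char psi.
Proof.
by move=> E [a [b [Ba Bb Eab]]]; exists a, b; split=> // g Lg; rewrite -E ?Eab.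
Qed.

Lemma brauer_charD a b :
  brauer_char a -> brauer_char b -> brauer_char (fun g => a g + b g).
Proof.
move=> [m [r [[r1 rM] Er]]] [n [s [[s1 sM] Es]]].
exists (m + n)%N, (fun g => block_mx (r g) 0 0 (s g)); split; last first.
  by move=> g Lg; rewrite brauer_trace_block Er // Es.
split=> [|g h Lg Lh]; first by rewrite r1 s1 -scalar_mx_block.
by rewrite mulmx_block rM // sM // !mul0mx !mulmx0 addr0 !add0r.
Qed.

Lemma brauer_charM a b :
  brauer_char a -> brauer_char b -> brauer_char (fun g => a g * b g).
Proof.
move=> [m [r [rr Er]]] [n [s [ss Es]]].
exists (m * n)%N, (fun g => r g *t s g); split; last first.
  move=> g Lg; rewrite Er // Es //.
  have [P [u [uP PA uE]]] := repr_diag rr Lg.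
  have [Q [v [uQ QB vE]]] := repr_diag ss Lg.
  by rewrite (brauer_trace_tens prim_omega prim_zeta uP PA uE uQ QB vE).
have [[r1 rM] [s1 sM]] := (rr, ss).
split=> [|g h Lg Lh]; last by rewrite tensmx_mul rM // sM.
rewrite r1 s1; apply/matrixP => i j; rewrite !mxE eq_mxtens.
by rewrite -natrM mulnb.
Qed.

Lemma brauer_char1 : brauer_char (fun=> 1).
Proof.
exists 1%N, (fun=> 1%:M); split; first by split=> // g h _ _; rewrite mul1mx.
move=> g _; rewrite (@brauer_trace_diag _ _ _ _ _ 1%:M _ (const_mx 1)) ?unitmx1 //.
  by rewrite big_ord1 mxE (root_lift1 prim_omega prim_zeta).
by rewrite !mulmx1 diag_const_mx.
Qed.

Lemma brauer_char0 : brauer_char (fun=> 0).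
Proof.
exists 0%N, (fun=> 1%:M); split; first by split=> // g h _ _; rewrite mul1mx.
move=> g _; rewrite (@brauer_trace_diag _ _ _ _ _ 1%:M _ 0) ?unitmx1 //.
  by rewrite big_ord0.
by apply/matrixP => -[].
Qed.

Lemma virtual_brauer phi : brauer_char phi -> virtual_char phi.
Proof.
by move=> Bphi; exists phi, (fun=> 0); split=> // [|g _]; [apply: brauer_char0 | rewrite subr0].
Qed.

Lemma virtual_charD a b :
  virtual_char a -> virtual_char b -> virtual_char (fun g => a g + b g).
Proof.
move=> [a1 [a2 [A1 A2 Ea]]] [b1 [b2 [B1 B2 Eb]]].
exists (fun g => a1 g + b1 g), (fun g => a2 g + b2 g); split; try exact: brauer_charD.
by move=> g Lg; rewrite Ea // Eb // opprD addrACA.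
Qed.

Lemma virtual_charN a : virtual_char a -> virtual_char (fun g => - a g).
Proof.
move=> [a1 [a2 [A1 A2 Ea]]]; exists a2, a1; split=> // g Lg.
by rewrite Ea // opprB.
Qed.

Lemma virtual_charM a b :
  virtual_char a -> virtual_char b -> virtual_char (fun g => a g * b g).
Proof.
move=> [a1 [a2 [A1 A2 Ea]]] [b1 [b2 [B1 B2 Eb]]].
exists (fun g => a1 g * b1 g + a2 g * b2 g), (fun g => a1 g * b2 g + a2 g * b1 g).
split; try by apply: brauer_charD; apply: brauer_charM.
by move=> g Lg; rewrite Ea // Eb //; ring.
Qed.

Lemma virtual_char0 : virtual_char (fun=> 0).
Proof. exact: virtual_brauer brauer_char0. Qed.

Lemma virtual_char1 : virtual_char (fun=> 1).
Proof. exact: virtual_brauer brauer_char1. Qed.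

Lemma virtual_char_int (z : int) : virtual_char (fun=> z%:~R).
Proof.
have nat_char n : virtual_char (fun=> n%:R).
  elim: n => [|n IHn]; first exact: virtual_char0.
  apply: virtual_char_ext (virtual_charD virtual_char1 IHn) => g _.
  by rewrite -natr1 addrC.
case: z => n; first exact: nat_char.
by apply: virtual_char_ext (virtual_charN (nat_char n.+1)) => g _; rewrite NegzE mulrNz.
Qed.

Lemma virtual_char_sum I (s : seq I) (P : pred I) (F : I -> gT -> algC) :
  (forall i, P i -> virtual_char (F i)) ->
  virtual_char (fun g => \sum_(i <- s | P i) F i g).
Proof.
move=> VF; elim: s => [|i s IHs].
  by apply: virtual_char_ext virtual_char0 => g _; rewrite big_nil.
have [Pi|nPi] := boolP (P i).
  by apply: virtual_char_ext (virtual_charD (VF i Pi) IHs) => g _; rewrite big_cons Pi.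
by apply: virtual_char_ext IHs => g _; rewrite big_cons (negPf nPi).
Qed.

Lemma virtual_char_prod I (s : seq I) (F : I -> gT -> algC) :
  (forall i, virtual_char (F i)) -> virtual_char (fun g => \prod_(i <- s) F i g).
Proof.
move=> VF; elim: s => [|i s IHs].
  by apply: virtual_char_ext virtual_char1 => g _; rewrite big_nil.
by apply: virtual_char_ext (virtual_charM (VF i) IHs) => g _; rewrite big_cons.
Qed.

Lemma sum_virtual_char phi : nilpotent L -> virtual_char phi ->
  exists z : int, \sum_(g in L) phi g = #|L|%:R * z%:~R.
Proof.
move=> nilL.
have sum_brauer a : brauer_char a -> exists k : nat, \sum_(g in L) a g = #|L|%:R * k%:R.
  move=> [m [r [rr Er]]].
  pose e := group_average r L.
  have E1 : \sum_(g in L) a g = #|L|%:R * brauer_trace #|L| omega zeta e.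
    have := sum_brauer_trace_coset prim_omega prim_zeta nilL rr (normal_refl L) (group1 L).
    rewrite (proj1 rr) mul1mx => <-; apply: eq_bigr => g Lg.
    by rewrite mul1g Er.
  have L0 : #|L|%:R != 0 :> K by apply: (prim_root_dvd_eq0 prim_omega).
  have e_idem : e *m e = e.
    rewrite {1}/e /group_average -scalemxAl mulmx_suml.
    rewrite (eq_bigr (fun=> e)) => [|h Lh].
      by rewrite sumr_const -scaler_nat scalerA mulVf // scale1r.
    rewrite /e /group_average -scalemxAr mulmx_sumr; congr (_ *: _).
    rewrite [RHS](reindex_inj (mulgI h)) /=.
    by apply: eq_big => [x|x Lx]; rewrite ?groupMl // (proj2 rr).
  have expE j : e ^+ j.+1 = e by elim: j => // j IHj; rewrite exprS IHj.
  have [P uP] := expS_diagonalizable prim_omega (expE _).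
  move=> /diagonalizable_forPex [v /(simmxP uP) Ev].
  have v01 i : (v 0 i == 0) || (v 0 i == 1).
    have : diag_mx v *m diag_mx v = diag_mx v.
      have : (diag_mx v *m diag_mx v) *m P = diag_mx v *m P.
        by rewrite -mulmxA -Ev mulmxA -Ev -mulmxA e_idem.
      by move/(congr1 (fun A => A *m invmx P)); rewrite !mulmxK.
    move/matrixP/(_ i i); rewrite mulmx_diag !mxE eqxx !mulr1n => /eqP.
    by rewrite -subr_eq0 -[X in _ - X]mulr1 -mulrBr mulf_eq0 subr_eq0.
  exists (\sum_i nat_of_bool (v ord0 i == 1%R))%N; rewrite E1 (brauer_trace_diag _ _ _ uP Ev) natr_sum.
  congr (_ * _); apply: eq_bigr => i _; case/orP: (v01 i) => /eqP ->.
    by rewrite (root_lift0 _ prim_omega) eq_sym oner_eq0.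
  by rewrite (root_lift1 prim_omega prim_zeta) eqxx.
move=> [a [b [/sum_brauer [k Ek] /sum_brauer [l El] Eab]]].
exists (k%:Z - l%:Z); rewrite (eq_bigr _ Eab) sumrB Ek El.
by rewrite intrB mulrBr.
Qed.

End VirtualCharacters.

(** * Symmetric and exterior powers *)

Section SymmetricPower.

Variables (K : fieldType) (n M k : nat).

Let idx := [pred m : 'X_{1..n.+1 < M} | mdeg m == k].
Let mon (i : 'I_#|idx|) : 'X_{1..n.+1} := enum_val i.

(** For k < M, the matrix of A on the symmetric power of degree k, in the basis of
    monomials. The bound M makes the monomials a finite type. *)
Definition sym_mx (A : 'M[K]_n.+1) : 'M[K]_#|idx| :=
  \matrix_(i, j) (lin_subst 'X_[mon i] A)@_(mon j).

Let mon_deg i : mdeg (mon i) = k.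
Proof. exact/eqP/(enum_valP i). Qed.

Let mon_inj i j : (mon i == mon j) = (i == j).
Proof. by rewrite -bmeqP (inj_eq enum_val_inj). Qed.

Let sym_expand (p : {mpoly K[n.+1]}) : (k < M)%N -> p \is k.-homog ->
  p = \sum_j p@_(mon j) *: 'X_[mon j].
Proof.
move=> ltkM pk.
have sp : (msize p <= M)%N := leq_trans (msize_homog pk) ltkM.
rewrite {1}(mpolywE sp) (bigID (fun m : 'X_{1..n.+1 < M} => mdeg m == k)) /=.
rewrite addrC big1 ?add0r => [|m mk]; last first.
  by rewrite (dhomog_nemf_coeff pk mk) scale0r.
by rewrite (big_enum_val (fun m : 'X_{1..n.+1 < M} => p@_m *: 'X_[m])).
Qed.

Lemma sym_mxM A B : sym_mx (A *m B) = sym_mx A *m sym_mx B.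
Proof.
apply/matrixP => i j; rewrite !mxE -lin_subst_mul.
have ltkM : (k < M)%N by rewrite -(mon_deg i) bmdeg.
have Xi : 'X_[mon i] \is [in K[n.+1], k.-homog] by rewrite dhomogX /= mon_deg.
rewrite {1}(sym_expand ltkM (dhomog_lin_subst A Xi)).
rewrite /lin_subst [in LHS](raddf_sum (comp_mpoly _)) linear_sum /=.
by apply: eq_bigr => l _; rewrite comp_mpolyZ mcoeffZ !mxE.
Qed.

Lemma sym_mx_diag (v : 'rV[K]_n.+1) :
  sym_mx (diag_mx v) = diag_mx (\row_i \prod_j v 0 j ^+ mon i j).
Proof.
apply/matrixP => i l; rewrite !mxE lin_substE mmapX /mmap1.
rewrite (eq_bigr (fun j => (v 0 j ^+ mon i j) *: 'X_j ^+ mon i j)) => [|j _].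
  rewrite scaler_prod -mpolyXE_id mcoeffZ mcoeffX mon_inj.
  by case: eqP => _; rewrite ?mulr1 ?mulr0.
rewrite -exprZn (bigD1 j) //= mxE eqxx mulr1n big1 ?addr0 // => a /negPf ja.
by rewrite mxE eq_sym ja mulr0n scale0r.
Qed.

Lemma sym_mx1 : sym_mx 1%:M = 1%:M.
Proof.
rewrite -diag_const_mx sym_mx_diag -diag_const_mx; congr diag_mx.
by apply/rowP => i; rewrite !mxE big1 // => j _; rewrite mxE expr1n.
Qed.

Lemma sym_mx_sum (V : nmodType) (F : 'X_{1..n.+1} -> V) :
  \sum_i F (mon i) = \sum_(m : 'X_{1..n.+1 < M} | mdeg m == k) F m.
Proof. by rewrite (big_enum_val (fun m : 'X_{1..n.+1 < M} => F m)). Qed.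

End SymmetricPower.

(** The generating series of the complete symmetric functions of a, truncated
    below degree M. *)
Definition complete_sym_poly n (a : 'I_n -> algC) M : {poly algC} :=
  \sum_(m : 'X_{1..n < M}) (\prod_i a i ^+ m i) *: 'X^(mdeg m).

Definition elem_sym_poly n (a : 'I_n -> algC) : {poly algC} :=
  \prod_i (1 - a i *: 'X).

Lemma coef_complete_sym_poly n (a : 'I_n -> algC) M k :
  (complete_sym_poly a M)`_k =
    \sum_(m : 'X_{1..n < M} | mdeg m == k) \prod_i a i ^+ m i.
Proof.
rewrite coef_sum [RHS]big_mkcond; apply: eq_bigr => m _.
by rewrite coefZ coefXn eq_sym; case: eqP; rewrite ?mulr1 ?mulr0.
Qed.

Lemma coef_mul_low (R : nzRingType) M (u p q : {poly R}) :
  (forall k, (k < M)%N -> p`_k = q`_k) ->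
  forall k, (k < M)%N -> (u * p)`_k = (u * q)`_k.
Proof.
move=> E k ltkM; rewrite !coefM; apply: eq_bigr => i _; rewrite E //.
by rewrite (leq_ltn_trans (leq_subr _ _)).
Qed.

Lemma elem_complete_sym n (a : 'I_n -> algC) M k : (k < M)%N ->
  (elem_sym_poly a * complete_sym_poly a M)`_k = (k == 0%N)%:R.
Proof.
move=> ltkM; case: M ltkM => // M ltkM.
pose G := \prod_i \sum_(j < M.+1) (a i *: 'X) ^+ j : {poly algC}.
have GE : G = \sum_(f : {ffun 'I_n -> 'I_M.+1})
    (\prod_i a i ^+ f i) *: 'X^(\sum_i f i)%N.
  rewrite /G bigA_distr_bigA; apply: eq_bigr => f _.
  rewrite -prodrXr -scaler_prod; apply: eq_bigr => i _.
  by rewrite exprZn.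
rewrite (@coef_mul_low _ M.+1 _ _ G) // => [|l ltlM].
  rewrite -big_split /=.
  have EG : \prod_i ((1 - a i *: 'X) * \sum_(j < M.+1) (a i *: 'X) ^+ j) =
      \prod_i (1 - (a i *: 'X) ^+ M.+1) :> {poly algC}.
    by apply: eq_bigr => i _; rewrite -[RHS]opprB subrX1 -mulNr opprB.
  rewrite EG; have [r ->] : exists r, \prod_i (1 - (a i *: 'X) ^+ M.+1) = 1 + r * 'X^(M.+1) :> {poly algC}.
    apply: (big_ind (fun p => exists r, p = 1 + r * 'X^(M.+1))) => [|_ _ [p ->] [q ->]|i _].
    - by exists 0; rewrite mul0r addr0.
    - by exists (p + q + p * q * 'X^(M.+1)); ring.
    by exists (- (a i ^+ M.+1)%:P); rewrite exprZn mulNr mul_polyC.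
  by rewrite coefD coef1 coefMXn ltkM addr0.
rewrite coef_complete_sym_poly GE coef_sum.
pose h (f : {ffun 'I_n -> 'I_M.+1}) : 'X_{1..n < M.+1} :=
  insubd (@bm0 n M) [multinom f i : nat | i < n].
pose h' (m : 'X_{1..n < M.+1}) : {ffun 'I_n -> 'I_M.+1} := [ffun i => inord (m i)].
have lt_m (m : 'X_{1..n < M.+1}) i : (m i < M.+1)%N.
  by apply: leq_ltn_trans (bmdeg m); rewrite mdegE (bigD1 i) //= leq_addr.
have hE (f : {ffun 'I_n -> 'I_M.+1}) : (\sum_i f i <= M)%N ->
    h f = [multinom f i : nat | i < n] :> 'X_{1..n}.
  move=> fM; rewrite /h val_insubd ifT // mdegE.
  by rewrite (eq_bigr (fun i => f i : nat)) // => i _; rewrite mnmE.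
rewrite (reindex_onto h h') => [|m _]; last first.
  apply/val_inj; rewrite /= hE; first by apply/mnmP => i; rewrite mnmE ffunE inordK.
  rewrite -ltnS (eq_bigr (fun i => m i)) => [|j _]; last by rewrite ffunE inordK.
  by rewrite -mdegE bmdeg.
transitivity (\sum_(f : {ffun 'I_n -> 'I_M.+1} | (\sum_i f i)%N == l) \prod_i a i ^+ f i).
  apply: eq_big => [f|f /andP [_ /eqP Ef]]; last first.
    by rewrite -[in RHS]Ef; apply: eq_bigr => i _; rewrite ffunE inordK.
  have [fM|fM] := leqP (\sum_i f i)%N M.
    rewrite hE // mdegE (eq_bigr (fun i => f i : nat)) => [|i _]; last by rewrite mnmE.
    rewrite andbC (_ : h' (h f) == f) //; apply/eqP/ffunP => i.
    by apply/val_inj; rewrite ffunE /= inordK // hE // mnmE.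
  rewrite [RHS]gtn_eqF ?(leq_trans ltlM) //; apply/negP => /andP [_ /eqP Ef].
  move: fM; rewrite ltnNge => /negP; apply.
  rewrite -Ef (eq_bigr (fun i => h f i)) => [|i _]; last by rewrite ffunE inordK.
  by rewrite -mdegE -ltnS bmdeg.
rewrite [LHS]big_mkcond; apply: eq_bigr => f _.
by rewrite coefZ coefXn eq_sym; case: eqP; rewrite ?mulr1 ?mulr0.
Qed.

Section Spectrum.

Variables (K : closedFieldType) (gT : finGroupType) (L : {group gT}).
Variables (omega : K) (zeta : algC).
Hypotheses (prim_omega : #|L|.-primitive_root omega) (prim_zeta : #|L|.-primitive_root zeta).

Let lift := root_lift #|L| omega zeta.
Let vchar := virtual_char L omega zeta.

Definition lifted_spectrum n (r : gT -> 'M[K]_n) (a : gT -> 'I_n -> algC) :=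
  forall g, g \in L -> exists P v, [/\ P \in unitmx, P *m r g = diag_mx v *m P,
    (forall i, v 0 i ^+ #|L| = 1) & forall i, a g i = lift (v 0 i)].

Lemma ex_lifted_spectrum n (r : gT -> 'M[K]_n) :
  mx_repr L r -> exists a, lifted_spectrum r a.
Proof.
move=> rr.
have spec g : exists a : 'I_n -> algC, g \in L ->
    exists P v, [/\ P \in unitmx, P *m r g = diag_mx v *m P,
    (forall i, v 0 i ^+ #|L| = 1) & forall i, a i = lift (v 0 i)].
  have [Lg|nLg] := boolP (g \in L); last by exists (fun=> 0).
  have [P [v [uP Pv vL]]] := repr_diag prim_omega rr Lg.
  by exists (fun i => lift (v 0 i)) => _; exists P, v.
by have [a aP] := fin_all_exists spec; exists a.
Qed.

Section Powers.

Variables (n : nat) (r : gT -> 'M[K]_n.+1) (a : gT -> 'I_n.+1 -> algC).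
Hypotheses (rr : mx_repr L r) (ra : lifted_spectrum r a).

Lemma virtual_complete_sym M k : vchar (fun g => (complete_sym_poly (a g) M)`_k).
Proof.
apply: virtual_brauer.
exists _, (fun g => sym_mx M k (r g)); split.
  split=> [|g h Lg Lh]; first by rewrite (proj1 rr) sym_mx1.
  by rewrite (proj2 rr) // sym_mxM.
move=> g Lg; have [P [v [uP Pv vL av]]] := ra Lg.
have uSP : sym_mx M k P \in unitmx.
  have E : sym_mx M k P *m sym_mx M k (invmx P) = 1%:M.
    by rewrite -sym_mxM mulmxV // sym_mx1.
  exact: (proj1 (mulmx1_unit E)).
rewrite (brauer_trace_diag _ _ _ uSP (v := \row_i \prod_j v 0 j ^+ (enum_val i : 'X_{1..n.+1 < M}) j)); last first.
  by rewrite -sym_mxM Pv sym_mxM sym_mx_diag.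
rewrite coef_complete_sym_poly -(@sym_mx_sum n M k _ (fun m : 'X_{1..n.+1} => \prod_i a g i ^+ m i)).
apply: eq_bigr => i _; rewrite mxE.
suff H (e : 'I_n.+1 -> nat) : (\prod_j v 0 j ^+ e j) ^+ #|L| = 1 /\
    lift (\prod_j v 0 j ^+ e j) = \prod_j a g j ^+ e j by rewrite -(proj2 (H _)).
elim/big_rec2: _ => [|j x y _ [yL yx]].
  by rewrite expr1n /lift (root_lift1 prim_omega prim_zeta).
have [jL jx] : (v 0 j ^+ e j) ^+ #|L| = 1 /\ lift (v 0 j ^+ e j) = a g j ^+ e j.
  elim: (e j) => [|d [IHL IHx]].
    by rewrite !expr0 expr1n /lift (root_lift1 prim_omega prim_zeta).
  rewrite !exprS exprMn IHL vL mulr1; split=> //.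
  by rewrite /lift (root_liftM prim_omega prim_zeta) // -/lift IHx av.
rewrite exprMn jL yL mulr1; split=> //.
by rewrite /lift (root_liftM prim_omega prim_zeta) // -/lift jx yx.
Qed.

(** The virtual character of an exterior power follows recursively from those of the
    symmetric powers, since their generating series are inverse to each other. *)
Lemma virtual_elem_sym k : vchar (fun g => (elem_sym_poly (a g))`_k).
Proof.
elim/ltn_ind: k => k IHk.
have E0 g : (elem_sym_poly (a g))`_0 = 1.
  rewrite -horner_coef0 horner_prod big1 // => i _.
  by rewrite hornerD hornerN hornerZ hornerX mulr0 subr0 hornerC.
have H0 g : (complete_sym_poly (a g) k.+1)`_0 = 1.
  have := @elem_complete_sym _ (a g) k.+1 0%N isT.
  by rewrite coefM big_ord1 E0 mul1r.
apply: (virtual_char_ext (phi := fun g => (k == 0%N)%:R + - \sum_(i < k)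
  (elem_sym_poly (a g))`_i * (complete_sym_poly (a g) k.+1)`_(k - i))) => [g _|].
  rewrite -(@elem_complete_sym _ (a g) k.+1 k) // coefM big_ord_recr /= subnn H0 mulr1.
  by rewrite addrAC subrr add0r.
apply: virtual_charD.
  exact: (virtual_char_int prim_omega prim_zeta (k == 0%N : nat)).
apply: virtual_charN; apply: virtual_char_sum => i _.
apply: (virtual_charM prim_omega prim_zeta); first exact: IHk.
exact: virtual_complete_sym.
Qed.

End Powers.

Lemma dual_spectrum n (r : gT -> 'M[K]_n) a : mx_repr L r -> lifted_spectrum r a ->
  mx_repr L (fun g => (r g^-1%g)^T) /\
  lifted_spectrum (fun g => (r g^-1%g)^T) (fun g i => (a g i)^-1).
Proof.
move=> [r1 rM] ra; split.
  split=> [|g h Lg Lh]; first by rewrite invg1 r1 trmx1.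
  by rewrite invMg rM ?groupV // trmx_mul.
move=> g Lg; have [P [v [uP Pv vL av]]] := ra g Lg.
have L_gt0 : (0 < #|L|)%N by apply: cardG_gt0.
have v0 i : v 0 i != 0.
  by apply: contra_eq_neq (vL i) => ->; rewrite expr0n gtn_eqF // eq_sym oner_neq0.
pose u := \row_i (v 0 i)^-1.
have uv : diag_mx u *m diag_mx v = 1%:M.
  by rewrite mulmx_diag; apply/matrixP => i j; rewrite !mxE mulVf.
have Pu : P *m r g^-1%g = diag_mx u *m P.
  have rV : r g *m r g^-1%g = 1%:M by rewrite -rM ?groupV // mulgV r1.
  have : diag_mx u *m (P *m r g) *m r g^-1%g = diag_mx u *m P.
    by rewrite -!mulmxA rV mulmx1.
  by rewrite Pv mulmxA uv mul1mx.
have uPT : invmx P^T \in unitmx by rewrite unitmx_inv unitmx_tr.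
exists (invmx P^T), u; split=> // [|i|i].
- apply: (can_inj (mulKmx (_ : P^T \in unitmx))); rewrite ?unitmx_tr //.
  rewrite mulKVmx ?unitmx_tr // !mulmxA.
  have /(congr1 trmx) := Pu; rewrite !trmx_mul tr_diag_mx => <-.
  by rewrite mulmxK ?unitmx_tr.
- by rewrite mxE exprVn vL invr1.
rewrite mxE av; apply: (mulfI (_ : lift (v 0 i) != 0)).
  apply/eqP => E; have := root_lift_root prim_omega prim_zeta (vL i).
  by rewrite -/lift E expr0n gtn_eqF // => /eqP; rewrite eq_sym oner_eq0.
rewrite mulfV; last first.
  apply/eqP => E; have := root_lift_root prim_omega prim_zeta (vL i).
  by rewrite -/lift E expr0n gtn_eqF // => /eqP; rewrite eq_sym oner_eq0.
rewrite /lift -(root_liftM prim_omega prim_zeta) ?exprVn ?vL ?invr1 //.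
by rewrite mulfV // (root_lift1 prim_omega prim_zeta).
Qed.

End Spectrum.

(** * The quotient of two characteristic polynomials *)

Section Quotient.

Variables (n e : nat) (a : 'I_n -> algC).
Hypotheses (e_gt0 : (0 < e)%N) (a_neq0 : forall i, a i != 0).
Hypothesis a_count : forall i0,
  (#|[set i | a i == a i0]| <= #|[set i | (a i * a i0 ^+ e)%R == 1%R]|)%N.

Let A : {poly algC} := elem_sym_poly (fun i => (a i)^-1) \Po 'X^e.
Let B : {poly algC} := elem_sym_poly a.

Let AE : A = \prod_i (1 - (a i)^-1 *: 'X^e).
Proof.
rewrite /A /elem_sym_poly rmorph_prod; apply: eq_bigr => i _ /=.
by rewrite comp_polyB comp_polyC comp_polyZ comp_polyX.
Qed.

(** The root of 1 - (a i0) X is a root of a factor of A for each i such that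
    a i * (a i0)^e = 1, and these are at least as many as the factors of B with that root. *)
Lemma elem_sym_dvd : B %| A.
Proof.
have A0 : A != 0.
  apply/eqP => /(congr1 (fun p : {poly algC} => p.[0])); rewrite horner0 AE horner_prod.
  rewrite big1 => [/eqP|i _]; first by rewrite oner_eq0.
  by rewrite hornerD hornerN hornerZ hornerXn hornerC expr0n gtn_eqF // mulr0 subr0.
have [t At] := closed_field_poly_normal A; pose s := [seq (a i)^-1 | i : 'I_n].
have BE : B = (\prod_i - a i) *: \prod_(z <- s) ('X - z%:P).
  rewrite big_image /= -scaler_prod; apply: eq_bigr => i _.
  by rewrite scalerBr !scaleNr scale_polyC divff // opprK addrC.
have lA : lead_coef A != 0 by rewrite lead_coef_eq0.
have B0 : \prod_i - a i != 0 by rewrite prodf_seq_neq0; apply/allP => i _; rewrite /= oppr_eq0.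
have count_le z : (count_mem z s <= count_mem z t)%N.
  have -> : count_mem z t = mup z A.
    by rewrite At -mul_polyC mupMr ?rootC // mu_prod_XsubC.
  rewrite mup_geq // /s count_map.
  have [/hasP [i0 _ /= /eqP Ez]|] := boolP (has (preim (fun i => (a i)^-1) (pred1 z)) (enum 'I_n)); last first.
    by rewrite has_count -leqNgt leqn0 => /eqP ->; rewrite expr0 dvd1p.
  rewrite -Ez (eq_count (a2 := [pred i | a i == a i0])) => [|i /=]; last by rewrite (inj_eq invr_inj).
  have -> : count [pred i | a i == a i0] (enum 'I_n) = #|[set i | a i == a i0]|.
    by rewrite cardsE cardE size_filter enumT.
  apply: dvdp_trans (dvdp_exp2l _ (a_count i0)) _.
  rewrite AE (bigID [pred i | i \in [set i | a i * a i0 ^+ e == 1]]) /=.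
  apply: dvdp_mulr; rewrite -prodr_const; apply: (big_ind2 (fun p q : {poly algC} => p %| q)) => [|p1 q1 p2 q2 d1 d2|i].
  - exact: dvdpp.
  - exact: dvdp_mul.
  rewrite inE => /eqP ai; rewrite dvdp_XsubCl rootE hornerD hornerN hornerZ hornerXn hornerC.
  by rewrite exprVn -invfM ai invr1 subrr.
rewrite BE dvdpZl // At dvdpZr //.
have [s' sub_s' perm_s] := (count_subseqP s t).1 (fun z => count_le z).
have [u perm_t] := perm_to_subseq sub_s'.
rewrite (perm_big _ perm_s) (perm_big _ perm_t) big_cat /=.
exact: dvdp_mulr.
Qed.

(** In A / B a factor with a i = 1 gives (1 - X^e) / (1 - X), whose value at 1 is e, and any
    other factor has the value (1 - (a i)^-1) / (1 - a i) = - (a i)^-1. *)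
Lemma elem_sym_quotient1 Q : A = Q * B ->
  (\prod_i - a i) * Q.[1] = (- e%:R) ^+ #|[set i | a i == 1]|.
Proof.
move=> AQB; pose c := #|[set i | a i == 1]|.
pose A1 := \prod_(i | a i != 1) (1 - (a i)^-1 *: 'X^e) : {poly algC}.
pose B1 := \prod_(i | a i != 1) (1 - a i *: 'X) : {poly algC}.
have splitB : B = (1 - 'X) ^+ c * B1.
  rewrite /B /elem_sym_poly (bigID (fun i => a i == 1)) /=; congr (_ * _).
  rewrite (eq_bigr (fun=> 1 - 'X)) => [|i /eqP ->]; last by rewrite scale1r.
  by rewrite prodr_const /c cardsE.
have splitA : A = (1 - 'X) ^+ c * ((\sum_(i < e) 'X^i) ^+ c * A1).
  rewrite AE (bigID (fun i => a i == 1)) /= mulrA; congr (_ * _).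
  rewrite (eq_bigr (fun=> 1 - 'X^e)) => [|i /eqP ->]; last by rewrite invr1 scale1r.
  rewrite prodr_const -exprMn /c cardsE; congr (_ ^+ _).
  by rewrite -opprB subrX1 -mulNr opprB.
have E1 : (\sum_(i < e) 'X^i) ^+ c * A1 = Q * B1.
  have X1 : (1 - 'X) ^+ c != 0 :> {poly algC}.
    by rewrite expf_neq0 // -opprB oppr_eq0 polyXsubC_eq0.
  by apply: (mulfI X1); rewrite -splitA AQB splitB mulrCA.
have /(congr1 (fun p : {poly algC} => p.[1])) := E1.
have geo1 : (\sum_(i < e) 'X^i).[1] = e%:R :> algC.
  rewrite horner_sum -[e in e%:R]card_ord -sumr_const; apply: eq_bigr => i _.
  by rewrite hornerXn expr1n.
rewrite !hornerM horner_exp geo1 /A1 /B1 !horner_prod => E2.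
have B1_neq0 : \prod_(i | a i != 1) (1 - a i *: 'X).[1] != 0.
  apply/prodf_neq0 => i ai.
  by rewrite hornerD hornerN hornerZ hornerX hornerC mulr1 subr_eq0 eq_sym.
apply: (mulIf B1_neq0); rewrite -mulrA -E2.
rewrite (bigID (fun i => a i == 1)) /= (eq_bigr (fun=> -1)) => [|i /eqP -> //].
rewrite prodr_const -/c -cardsE -/c.
rewrite [(- e%:R) ^+ c]exprNn -!mulrA; congr (_ * _).
rewrite mulrCA; congr (_ * _); rewrite -big_split; apply: eq_bigr => i ai /=.
rewrite !(hornerE, hornerXn) expr1n mulr1 mulrBr mulr1 mulNr opprK mulfV //.
by rewrite addrC.
Qed.

End Quotient.

(** * The order of the stabilizer *)

Lemma closed_prim_root (K : closedFieldType) N :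
  (0 < N)%N -> N%:R != 0 :> K -> exists omega : K, N.-primitive_root omega.
Proof.
move=> N_gt0 N0; have [s Es] := closed_field_poly_normal ('X^N - 1 : {poly K}).
have sX : size ('X^N - 1 : {poly K}) = N.+1 by rewrite -polyC1 size_XnsubC.
have lX : lead_coef ('X^N - 1 : {poly K}) = 1.
  by apply/monicP; rewrite -polyC1 monicXnsubC.
rewrite lX scale1r in Es.
have us : uniq s by rewrite -separable_prod_XsubC -Es separable_Xn_sub_1.
have size_s : size s = N.
  by apply: succn_inj; rewrite -sX Es size_prod_XsubC.
have rs : all N.-unity_root s.
  apply/allP => x xs; rewrite unity_rootE -subr_eq0.
  have : root ('X^N - 1) x by rewrite Es root_prod_XsubC.
  by rewrite rootE !hornerE.
have := has_prim_root N_gt0 rs us; rewrite size_s leqnn => /(_ isT) /hasP [x _ px].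
by exists x.
Qed.

Lemma elem_sym_top n (a : 'I_n -> algC) :
  (size (elem_sym_poly a) <= n.+1)%N /\ (elem_sym_poly a)`_n = \prod_i - a i.
Proof.
suff H (s : seq 'I_n) :
    (size (\prod_(i <- s) (1 - a i *: 'X : {poly algC}))%R <= (size s).+1)%N /\
    (\prod_(i <- s) (1 - a i *: 'X : {poly algC}))`_(size s) = \prod_(i <- s) - a i.
  have := H (enum 'I_n); rewrite size_enum_ord !big_enum; exact.
elim: s => [|i s [IHs IHtop]]; first by rewrite !big_nil size_poly1 coef1.
have s1 : (size (1 - a i *: 'X : {poly algC})%R <= 2)%N.
  rewrite (leq_trans (size_polyD _ _)) // geq_max size_poly1 size_polyN.
  by rewrite (leq_trans (size_scale_leq _ _)) ?size_polyX.
have [] := coef_mul_top s1 IHs; rewrite !big_cons add1n => -> ->; split=> //.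
by rewrite IHtop coefB coef1 coefZ coefX mulr1 sub0r.
Qed.

Section Faithful.

Variables (K : closedFieldType) (n d : nat) (f : {mpoly K[n.+1]}).
Hypotheses (d_gt2 : (2 < d)%N) (f_homog : f \is d.-homog) (smooth_f : ~ singular_form f).
Variables (gT : finGroupType) (L : {group gT}) (r : gT -> 'M[K]_n.+1).
Hypotheses (nilL : nilpotent L) (r_repr : mx_repr L r) (L_neq0 : #|L|%:R != 0 :> K).
Hypothesis r_stab : forall g, g \in L -> lin_stab f (r g).
Hypothesis r_faithful : forall g, g \in L -> r g = 1%:M -> g = 1%g.

Let q : int := 1 - d%:Z.

(** The value at g of the virtual character is the power of 1 - d whose exponent is the
    dimension of the fixed space of g. Hence the product of its differences with the
    q^k, for k <= n, is supported at the identity, where it is the bound. *)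
Lemma card_dvd_stab_bound : (#|L|%:Z %| \prod_(k < n.+1) (q ^+ n.+1 - q ^+ k))%Z.
Proof.
have L_gt0 : (0 < #|L|)%N by apply: cardG_gt0.
have [omega prim_omega] := closed_prim_root L_gt0 L_neq0.
have [zeta prim_zeta] := C_prim_root_exists L_gt0.
have [a ra] := ex_lifted_spectrum zeta prim_omega r_repr.
have [dual_repr dual_ra] := dual_spectrum prim_omega prim_zeta r_repr ra.
pose lift := root_lift #|L| omega zeta.
pose vchar := virtual_char L omega zeta.
pose e := d.-1; have e_gt0 : (0 < e)%N by rewrite /e; case: (d) d_gt2 => [|[]].
pose M := (n.+1 * e).+1.
pose A g := elem_sym_poly (fun i => (a g i)^-1) \Po 'X^e.
(* The sum is the value at 1 of A / B, as M exceeds the degree of this quotient; the first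
   factor is the product of the - a i. *)
pose psi g := (elem_sym_poly (a g))`_n.+1 *
  \sum_(k < M) (A g * complete_sym_poly (a g) M)`_k.
pose fix_dim g := #|[set i | a g i == 1]|.
have vpsi : vchar psi.
  apply: (virtual_charM prim_omega prim_zeta).
    exact: (virtual_elem_sym prim_omega prim_zeta r_repr ra).
  apply: virtual_char_sum => k _.
  apply: (virtual_char_ext (phi := fun g => \sum_(i < k.+1)
     (A g)`_i * (complete_sym_poly (a g) M)`_(k - i))) => [g _|]; first by rewrite coefM.
  apply: virtual_char_sum => i _; apply: (virtual_charM prim_omega prim_zeta); last first.
    exact: (virtual_complete_sym prim_omega prim_zeta r_repr ra).
  have [ei|ei] := boolP (e %| i)%N; last first.
    apply: virtual_char_ext (virtual_char0 _ _ _) => g _.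
    by rewrite /A coef_comp_poly_Xn // (negPf ei).
  apply: virtual_char_ext (virtual_elem_sym prim_omega prim_zeta dual_repr dual_ra (i %/ e)) => g _.
  by rewrite /A coef_comp_poly_Xn // ei.
have psiE g : g \in L -> psi g = (- e%:R) ^+ fix_dim g.
  move=> Lg; have [P [v [uP Pv vL av]]] := ra g Lg.
  have a_neq0 i : a g i != 0.
    apply/eqP => ai0; have := root_lift_root prim_omega prim_zeta (vL i).
    by rewrite -av ai0 expr0n gtn_eqF // => /eqP; rewrite eq_sym oner_eq0.
  (* In eigencoordinates of r g the form f becomes f', which is stabilized by a diagonal
     matrix. *)
  pose f' := lin_subst f (invmx P).
  have uV : invmx P \in unitmx by rewrite unitmx_inv.
  have f'_smooth : ~ singular_form f' by move/(singular_form_lin_subst uV).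
  have f'_homog : f' \is d.-homog by apply: dhomog_lin_subst.
  have f'_stab : lin_stab f' (diag_mx v).
    split.
      have -> : diag_mx v = P *m r g *m invmx P by rewrite Pv mulmxK.
      by rewrite !unitmx_mul uP uV (proj1 (r_stab Lg)).
    rewrite /f' lin_subst_mul.
    have -> : invmx P *m diag_mx v = r g *m invmx P.
      by apply: (can_inj (mulKmx uP)); rewrite mulKVmx // mulmxA Pv mulmxK.
    by rewrite -lin_subst_mul (proj2 (r_stab Lg)).
  have a_count i0 :
      (#|[set i | a g i == a g i0]| <= #|[set i | (a g i * a g i0 ^+ e)%R == 1%R]|)%N.
    have v_neq0 : v 0 i0 != 0.
      by apply: contra_eq_neq (vL i0) => ->; rewrite expr0n gtn_eqF // eq_sym oner_neq0.
    have := diag_stab_eigenvalues d_gt2 f'_homog f'_smooth f'_stab v_neq0.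
    rewrite -/e; congr (_ <= _)%N; apply: eq_card => i; rewrite !inE.
      rewrite !av; apply/eqP/eqP => [-> //|].
      exact: (root_lift_inj prim_omega prim_zeta (vL _) (vL _)).
    have powL j : (v 0 i0 ^+ j) ^+ #|L| = 1 by rewrite exprAC vL expr1n.
    have liftX j : a g i0 ^+ j = lift (v 0 i0 ^+ j).
      elim: j => [|j IHj]; first by rewrite !expr0 /lift (root_lift1 prim_omega prim_zeta).
      by rewrite !exprS IHj av /lift (root_liftM prim_omega prim_zeta).
    rewrite liftX av -(root_liftM prim_omega prim_zeta) //.
    apply/eqP/eqP => [->|]; first exact: (root_lift1 prim_omega prim_zeta).
    by apply: (root_lift_eq1 prim_omega prim_zeta); rewrite exprMn vL powL mulr1.
  have /dvdpP [Q AQB] := elem_sym_dvd e_gt0 a_neq0 a_count.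
  rewrite -(elem_sym_quotient1 a_neq0 AQB) /psi (proj2 (elem_sym_top (a g))).
  congr (_ * _).
  have sA : (size (A g) <= M)%N.
    rewrite (leq_trans (size_comp_poly_leq _ _)) // ltnS size_polyXn leq_mul //.
    by have [] := elem_sym_top (fun i => (a g i)^-1); case: size.
  have B0 : elem_sym_poly (a g) != 0.
    apply/eqP => E; have := elem_complete_sym (a g) (ltn0Sn M).
    by rewrite E mul0r coef0 => /eqP; rewrite eq_sym oner_eq0.
  have sQ : (size Q <= M)%N.
    have [->|Q0] := eqVneq Q 0; first by rewrite size_poly0.
    apply: leq_trans sA; rewrite /A AQB size_mul //.
    by rewrite (polySpred B0) addnS /= leq_addr.
  rewrite (horner_coef_wide _ sQ); apply: eq_bigr => k _; rewrite expr1n mulr1.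
  rewrite /A AQB -mulrA (@coef_mul_low _ M _ _ 1) ?mulr1 // => l ltlM.
  by rewrite elem_complete_sym // coef1.
pose theta g := \prod_(k < n.+1) (psi g + (- (q ^+ k))%:~R).
have vtheta : vchar theta.
  apply: (virtual_char_prod prim_omega prim_zeta) => k.
  by apply: virtual_charD => //; apply: virtual_char_int.
have qE : q%:~R = - e%:R :> algC.
  rewrite /q /e; case: (d) d_gt2 => // d' _.
  by rewrite rmorphB /= -pmulrn -natr1 opprD addrCA subrr addr0.
have fix_dim_le g : (fix_dim g <= n.+1)%N by rewrite -[n.+1]card_ord max_card.
have theta0 g : g \in L -> g != 1%g -> theta g = 0.
  move=> Lg g1; have [ltg|] := ltnP (fix_dim g) n.+1.
    rewrite /theta (bigD1 (Ordinal ltg)) //= psiE // -qE -rmorphXn -rmorphD /=.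
    by rewrite subrr mul0r.
  move=> full; case/eqP: g1; apply: r_faithful => //.
  have [P [v [uP Pv vL av]]] := ra g Lg.
  have a1 i : a g i = 1.
    have : [set i | a g i == 1] == setT.
      by rewrite eqEcard subsetT cardsT card_ord.
    by move/eqP/setP/(_ i); rewrite !inE => /eqP.
  have v1 : v = const_mx 1.
    apply/rowP => i; rewrite mxE; apply: (root_lift_eq1 prim_omega prim_zeta (vL i)).
    by rewrite -av a1.
  rewrite -[r g](mulKmx uP) Pv v1 diag_const_mx mul1mx mulVmx //.
have theta1 : theta 1%g = (\prod_(k < n.+1) (q ^+ n.+1 - q ^+ k))%:~R.
  have [P [v [uP Pv vL av]]] := ra 1%g (group1 L).
  suff full : fix_dim 1%g = n.+1.
    rewrite /theta rmorph_prod; apply: eq_bigr => k _.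
    by rewrite psiE // full -qE -rmorphXn -rmorphD.
  rewrite -[RHS]card_ord -cardsT; apply: eq_card => i; rewrite !inE av.
  have /(congr1 (fun B => B *m invmx P)) := Pv.
  rewrite (proj1 r_repr) mulmx1 mulmxK // mulmxV // => /matrixP/(_ i i).
  by rewrite !mxE eqxx !mulr1n => <-; rewrite (root_lift1 prim_omega prim_zeta) eqxx.
have [z Ez] := sum_virtual_char prim_omega prim_zeta nilL vtheta.
rewrite (bigD1 1%g) //= big1 ?addr0 in Ez; last by move=> g /andP [Lg g1]; apply: theta0.
apply/dvdzP; exists z; apply: (@intr_inj algC).
by rewrite -theta1 Ez rmorphM /= mulrC.
Qed.

End Faithful.

Section MatrixGroup.

Variables (K : fieldType) (n : nat) (G : {fset 'M[K]_n}).

Record matrix_group_axioms : Prop := MatrixGroupAxioms {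
  mxgroup1 : 1%:M \in G;
  mxgroupM : forall A B, A \in G -> B \in G -> A *m B \in G;
  mxgroupV : forall A, A \in G -> invmx A \in G;
  mxgroup_unit : forall A, A \in G -> A \in unitmx }.

Hypothesis Ggrp : matrix_group_axioms.

(** The group structure depends on the proof Ggrp of the axioms, so it is put on an
    alias of the finite type of elements of G that carries this proof. *)
Definition mxgroup_of of matrix_group_axioms : Type := G.
Local Notation gT := (mxgroup_of Ggrp).

HB.instance Definition _ := Finite.on gT.

Let mul (x y : gT) : gT := [` mxgroupM Ggrp (fsvalP x) (fsvalP y)]%fset.
Let one : gT := [` mxgroup1 Ggrp]%fset.
Let inv (x : gT) : gT := [` mxgroupV Ggrp (fsvalP x)]%fset.

Let mulA : associative mul.
Proof. by move=> x y z; apply/val_inj; rewrite /= mulmxA. Qed.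

Let mul1 : left_id one mul.
Proof. by move=> x; apply/val_inj; rewrite /= mul1mx. Qed.

Let mulV : left_inverse one inv mul.
Proof. by move=> x; apply/val_inj; rewrite /= mulVmx // mxgroup_unit // fsvalP. Qed.

HB.instance Definition _ := Finite_isGroup.Build gT mulA mul1 mulV.

Definition mxgroup_val (x : gT) : 'M[K]_n := fsval x.

Lemma mxgroup_val_repr (L : {group gT}) : mx_repr L mxgroup_val.
Proof. by []. Qed.

Lemma mxgroup_val_mem x : mxgroup_val x \in G.
Proof. exact: fsvalP. Qed.

Lemma mxgroup_val_faithful x : mxgroup_val x = 1%:M -> x = 1%g.
Proof. by move=> x1; apply/val_inj. Qed.

Lemma card_mxgroup : #|[set: gT]| = #|` G|%fset.
Proof. by rewrite cardsT cardfE. Qed.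

End MatrixGroup.

(** Up to sign, this is the order of GL_(n+1) over a field with 1 - d elements, if
    there were one. *)
Lemma stab_boundE n d :
  \prod_(i < n.+1) (((-1) ^+ (n - i) + (d%:Z - 1) ^+ (n - i + 1)) * (d%:Z - 1) ^+ i)
    = ((-1) ^+ n.+1) ^+ n.+1 *
      \prod_(k < n.+1) ((1 - d%:Z) ^+ n.+1 - (1 - d%:Z) ^+ k) :> int.
Proof.
rewrite -[X in _ ^+ X * _]card_ord -prodr_const -big_split; apply: eq_bigr => i _ /=.
have lein : (i <= n)%N by rewrite -ltnS ltn_ord.
have powE (x : int) : x ^+ n.+1 = x ^+ i * (x ^+ (n - i) * x).
  by rewrite -exprSr -exprD addnS subnKC.
rewrite -[1 - d%:Z]opprB; set c := d%:Z - 1; rewrite !powE ![(- c) ^+ _]exprNn exprD expr1.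
have sq (j : nat) : (-1) ^+ j * (-1) ^+ j = 1 :> int by rewrite -expr2 sqrr_sign.
move: (sq i) (sq (n - i)%N).
set u := (-1) ^+ i; set w := (-1) ^+ (n - i); set x := c ^+ i; set y := c ^+ (n - i).
move=> uu ww; transitivity ((u * u) * (w * w) * (x * (y * c)) + (u * u) * w * x).
  by rewrite uu ww; ring.
by ring.
Qed.

Theorem theorem4 (p : nat) (K : closedFieldType) (hp : p \in [pchar K])
    (n d : nat) (hd : (2 < d)%N) (f : {mpoly K[n.+1]})
    (hf : f \is d.-homog) (hs : ~ singular_form f) :
  exists G : {fset 'M[K]_n.+1},
    (forall A : 'M[K]_n.+1, A \in G <-> lin_stab f A) /\
    ((#|` G|%fset`_p^')%N%:Z %|
       \prod_(i < n.+1)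
         (((-1) ^+ (n - i) + (d%:Z - 1) ^+ (n - i + 1)) * (d%:Z - 1) ^+ i))%Z.
Proof.
have [G GP] := lin_stab_finite hd hf hs.
exists G; split=> //.
have Ggrp : matrix_group_axioms G.
  split=> [|A B|A|A]; rewrite ?GP.
  - exact: lin_stab1.
  - exact: lin_stabM.
  - exact: lin_stabV.
  - by case.
pose gT : finGroupType := mxgroup_of Ggrp.
rewrite dvdzE absz_nat; set m := partn _ _.
have m_gt0 : (0 < m)%N by apply: part_gt0.
apply/dvdn_partP => // l lm.
have l_prime : prime l by move: lm; rewrite mem_primes => /andP[].
have l_p : l != p.
  by have := pnatPpi (part_pnat p^' #|` G|%fset) lm; rewrite !inE.
have [L sylL] := Sylow_exists l [set: gT].
have -> : (m`_l)%N = #|L|.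
  rewrite (card_Hall sylL) card_mxgroup partn_part // => i.
  by rewrite !inE => /eqP ->.
have lL := pHall_pgroup sylL.
have L_neq0 : #|L|%:R != 0 :> K.
  rewrite -(dvdn_pcharf hp); apply: contra l_p => pL.
  have := pgroupP lL p (pcharf_prime hp) pL.
  by rewrite inE eq_sym.
have := @card_dvd_stab_bound K n d f hd hf hs gT L (@mxgroup_val _ _ _ Ggrp)
  (pgroup_nil lL) (mxgroup_val_repr L) L_neq0 _ _.
rewrite dvdzE absz_nat stab_boundE abszM => H.
apply: dvdn_mull; apply: H.
  by move=> g _; apply/GP/mxgroup_val_mem.
by move=> g _; apply: mxgroup_val_faithful.
Qed.
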